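(* Let $k\ge 1$ be an integer and $n\ge 64k^6$. Let $\mathcal{G}'_{n,k}$ be the family of simple graphs of order $n$ with maximum degree $n-1$ that do not contain $k$ pairwise edge-disjoint cycles and that have the maximum number of edges among all such graphs. Let $\mathcal{G}''_{n,k}$ be the family of simple graphs of order $n$ that do not contain $k$ pairwise edge-disjoint cycles and that have the maximum spectral radius among all such graphs. Then $\mathcal{G}''_{n,k}\subseteq \mathcal{G}'_{n,k}$.
   Context: The spectral radius of a graph is the largest eigenvalue of its adjacency matrix. Graphs are not assumed planar here. *)

(* Defs.v *)
From HB Require Import structures.
From mathcomp Require Import all_boot all_order all_algebra.
From mathcomp Require Import reals.
Set Implicit Arguments. Unset Strict Implicit. Unset Printing Implicit Defensive.
Import Order.TTheory GRing.Theory Num.Theory.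

Definition simple_graph (n : nat) (e : rel 'I_n) : Prop :=
  irreflexive e /\ symmetric e.

Definition edge_set (n : nat) (e : rel 'I_n) : {set {set 'I_n}} :=
  [set [set x; y] | x in 'I_n, y in 'I_n & e x y].

Definition num_edges (n : nat) (e : rel 'I_n) : nat := #|edge_set e|.

Definition degree (n : nat) (e : rel 'I_n) (v : 'I_n) : nat := #|[set w | e v w]|.

Definition max_degree (n : nat) (e : rel 'I_n) : nat := \max_(v : 'I_n) degree e v.

Definition is_cycle (n : nat) (e : rel 'I_n) (s : seq 'I_n) : Prop :=
  [/\ 3 <= size s, uniq s & cycle e s].

Definition cycle_edges (n : nat) (s : seq 'I_n) : {set {set 'I_n}} :=
  [set [set x; next s x] | x in s].

Definition has_k_edge_disjoint_cycles (n : nat) (e : rel 'I_n) (k : nat) : Prop :=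
  exists C : 'I_k -> seq 'I_n,
    (forall i, is_cycle e (C i)) /\
    (forall i j, i != j -> [disjoint cycle_edges (C i) & cycle_edges (C j)]).

Definition adj_mx (R : realType) (n : nat) (e : rel 'I_n) : 'M[R]_n :=
  (\matrix_(i, j) (e i j)%:R)%R.

Definition is_spectral_radius (R : realType) (n : nat) (e : rel 'I_n) (r : R) : Prop :=
  eigenvalue (adj_mx R e) r /\
  (forall mu : R, eigenvalue (adj_mx R e) mu -> (mu <= r)%R).

Definition admissible (n k : nat) (e : rel 'I_n) : Prop :=
  simple_graph e /\ ~ has_k_edge_disjoint_cycles e k.

Definition in_G1 (n k : nat) (e : rel 'I_n) : Prop :=
  [/\ admissible k e, max_degree e = n.-1 &
      forall f : rel 'I_n, admissible k f -> max_degree f = n.-1 ->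
        num_edges f <= num_edges e].

Definition in_G2 (R : realType) (n k : nat) (e : rel 'I_n) : Prop :=
  admissible k e /\
  exists r : R, is_spectral_radius e r /\
    forall (f : rel 'I_n) (rf : R), admissible k f -> is_spectral_radius f rf ->
      (rf <= r)%R.

(* Main.v *)
Require Import Defs.
From mathcomp Require Import all_boot all_order all_algebra.
From mathcomp Require Import reals.
From mathcomp Require Import zify ring lra.
From mathcomp Require classical_sets topology normedtype derive.

(** Let [K] be the bound on edge-disjoint cycles, [G] a spectral extremal graph
    with radius [rho], and [x] its Perron vector scaled so that its largest entry
    is [x v = 1].

    Combinatorics. Modulo 2, cycles become nonempty edge sets with all degrees
    even.  Contracting vertices of degree 2 and using the Moore bound (a graph of
    minimum degree 3 has a logarithmically short cycle), induction on [K] shows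
    that a graph without [K] edge-disjoint cycles has fewer than [n + 4K^2 - 3]
    edges.  Moreover two vertices have at most [2K - 1] common neighbours
    (4-cycles), and a neighbourhood spans at most [2(2K - 1)(K - 1)] edges
    (triangles).

    A vertex of degree [n - 1].  Turning a non-neighbour [u] of [v] into a pendant
    vertex at [v] creates no cycle, so extremality gives [rho * x u > 1].  The
    star gives [rho^2 >= n - 1]; counting 2-walks from [v], the edge bound
    forces [G - v] to have maximum degree at most [D = O(K^2)].  Hence all
    entries other than [x v] are at most [1 / (rho - D)], and a non-neighbour
    would satisfy [1 < rho * x u <= D / (rho - D)], which fails as [2D <= rho].

    Number of edges.  When [v] has degree [n - 1] and [G - v] has [h] edges,
    [(rho^2 - (n - 1)) * rho] lies between [2h] and [2h * (1 + d / (rho - d))]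
    with [d = 2K - 1]; for [n >= 64 K^6] the second bound stays below
    [2 * (h + 1)], so more edges would mean a larger radius. *)

Set Implicit Arguments.
Unset Strict Implicit.
Unset Printing Implicit Defensive.

(** * Even edge sets and cycles *)

Section EvenEdgeSets.
Variable T : finType.
Implicit Types (E F G : {set {set T}}) (u v w : T) (k : nat).

Definition deg E v := #|[set A in E | v \in A]|.

Definition even_set E := forall v, ~~ odd (deg E v).

Definition symd E F := [set A | (A \in E) (+) (A \in F)].

Lemma in_symd E F A : (A \in symd E F) = (A \in E) (+) (A \in F).
Proof. by rewrite inE. Qed.

(** Even sets, unlike cycles, are closed under [symd], so packings can be modified by symmetric
    differences. Taking the sets out one at a time builds in their disjointness and suits induction
    on [k]. *)
Fixpoint packs k E : Prop :=
  if k is k'.+1 then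
    exists F, [/\ F \subset E, F != set0, even_set F & packs k' (E :\: F)]
  else True.

Lemma packs_sub k E F : E \subset F -> packs k E -> packs k F.
Proof.
elim: k E F => //= k IH E F sEF [G [sGE G0 evG pG]].
exists G; split=> //; first exact: subset_trans sGE sEF.
exact: IH (setSD _ sEF) pG.
Qed.

Lemma odd_deg_symd E F v : odd (deg (symd E F) v) = odd (deg E v) (+) odd (deg F v).
Proof.
have oddE G : odd (deg G v) = \big[addb/false]_(A : {set T}) ((A \in G) && (v \in A)).
  rewrite /deg -sum1dep_card (big_morph odd oddD (erefl : odd 0 = false)) big_mkcond /=.
  by apply: eq_bigr => A _; case: (_ && _).
rewrite !oddE -big_split /=; apply: eq_bigr => A _.
by rewrite in_symd; case: (A \in E); case: (A \in F); case: (v \in A).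
Qed.

Lemma even_symd E F : even_set E -> even_set F -> even_set (symd E F).
Proof. by move=> evE evF v; rewrite odd_deg_symd (negbTE (evE v)) (negbTE (evF v)). Qed.

Lemma deg_set1 (A : {set T}) v : deg [set A] v = (v \in A).
Proof.
rewrite /deg; case vA: (v \in A).
  by rewrite (_ : [set _ in _ | _] = [set A]) ?cards1 //; apply/setP=> B; rewrite !inE;
     case: eqP => // ->; rewrite vA.
apply/eqP; rewrite cards_eq0 -subset0; apply/subsetP=> B.
by rewrite !inE; case: eqP => // ->; rewrite vA.
Qed.

Lemma deg_edge u w v : u != w ->
  odd (deg [set [set u; w]] v) = (v == u) (+) (v == w).
Proof.
move=> uw; rewrite deg_set1 !inE.
by case: eqP => [->|_] /=; [rewrite (negbTE uw) | case: eqP].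
Qed.

Lemma deg_sub E F v : E \subset F -> deg E v <= deg F v.
Proof. by move=> sEF; apply/subset_leq_card/subsetP=> A; rewrite !inE => /andP[/(subsetP sEF)-> ->]. Qed.

Lemma deg_gt0P E v : reflect (exists2 A, A \in E & v \in A) (0 < deg E v).
Proof.
rewrite /deg card_gt0; apply: (iffP (set0Pn _)) => -[A].
  by rewrite inE => /andP[? ?]; exists A.
by exists A; rewrite inE; apply/andP.
Qed.

Lemma sum_deg E : (forall A, A \in E -> #|A| = 2) -> \sum_v deg E v = (#|E|).*2.
Proof.
move=> gE.
have -> : \sum_v deg E v = \sum_v \sum_(A in E) (v \in A).
  apply: eq_bigr => v _; rewrite /deg -sum1dep_card big_mkcondr /=.
  by apply: eq_bigr => A _; case: (v \in A).
rewrite exchange_big /= (eq_bigr (fun=> 2)).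
  by rewrite sum_nat_const muln2.
by move=> A /gE <-; rewrite -sum1_card [in RHS]big_mkcond; apply: eq_bigr => v _; case: (v \in A).
Qed.

Lemma card_symd E F : #|symd E F| <= #|E| + #|F|.
Proof.
apply: leq_trans (leq_card_setU E F); apply/subset_leq_card/subsetP=> A.
by rewrite in_symd inE; case: (A \in E); case: (A \in F).
Qed.

Lemma symd_sub E F G : E \subset G -> F \subset G -> symd E F \subset G.
Proof.
move=> /subsetP sE /subsetP sF; apply/subsetP=> A; rewrite in_symd.
by case AE: (A \in E) => /=; [rewrite sE | move/sF].
Qed.

(** Where [E] has degree at most 1, an even subset has degree 0. Hence no set of the packing uses
    the one edge at [u] that [F] may lack. *)
Lemma packs_edges k E F u v :
  (forall A, A \in E -> A \in F \/ (A = [set u; v])) ->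
  deg E u <= 1 -> packs k E -> packs k F.
Proof.
elim: k E F => //= k IH E F sEF dE [G [sGE G0 evG pG]].
have duG : deg G u = 0.
  by have := deg_sub u sGE; have := evG u; case: (deg G u) dE => // [[|d]] //; lia.
have nG A : A \in G -> u \notin A.
  by move=> AG; apply/negP=> uA; move/eqP: duG; rewrite -leqn0 leqNgt => /deg_gt0P[]; exists A.
exists G; split=> //.
  apply/subsetP=> A AG; case: (sEF A (subsetP sGE _ AG)) => // eA.
  by have := nG A AG; rewrite eA !inE eqxx.
apply: IH pG; last exact: leq_trans (deg_sub _ (subsetDl _ _)) dE.
by move=> A; rewrite !inE => /andP[AG /sEF[->|->]]; [left; rewrite AG|right].
Qed.

End EvenEdgeSets.

(** * Even edge sets of a graph and its cycles *)

Section Cycles.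
Variable n : nat.
Implicit Types (e : rel 'I_n) (s : seq 'I_n).

Lemma edge_setP e (A : {set 'I_n}) :
  reflect (exists u w, e u w /\ A = [set u; w]) (A \in edge_set e).
Proof.
apply: (iffP imset2P) => [[u w _ ew ->]|[u [w [ew ->]]]].
  by exists u, w; split=> //; move: ew; rewrite inE => /andP[].
by exists u w; rewrite ?inE.
Qed.

Lemma in_edge_set e u w : symmetric e -> ([set u; w] \in edge_set e) = e u w.
Proof.
move=> sym; apply/edge_setP/idP => [[a [b [eab eq]]]|euw]; last by exists u, w.
have: u \in [set a; b] by rewrite -eq !inE eqxx.
have: w \in [set a; b] by rewrite -eq !inE eqxx orbT.
have: a \in [set u; w] by rewrite eq !inE eqxx.
have: b \in [set u; w] by rewrite eq !inE eqxx orbT.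
rewrite !inE => /orP[]/eqP eb /orP[]/eqP ea /orP[]/eqP ew /orP[]/eqP eu; subst; by [|rewrite sym].
Qed.

Lemma edge_set_card2 e A : simple_graph e -> A \in edge_set e -> #|A| = 2.
Proof.
move=> [irr _] /edge_setP[u [w [euw ->]]]; rewrite cards2.
by case: eqP euw => // ->; rewrite irr.
Qed.

Lemma deg_edge_set e v : simple_graph e -> deg (edge_set e) v = degree e v.
Proof.
move=> [irr sym]; rewrite /deg /degree.
rewrite -(card_in_imset (f := fun w => [set v; w])); last first.
  move=> w1 w2; rewrite !inE => e1 e2 /setP /(_ w1); rewrite !inE eqxx orbT.
  by move/esym/orP=> []/eqP // ew; move: e1; rewrite ew irr.
apply: eq_card => A; rewrite inE; apply/andP/imsetP.
  case=> /edge_setP[u [w [euw ->]]]; rewrite !inE => /orP[]/eqP ->.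
    by exists w; rewrite ?inE.
  by exists u; rewrite ?inE 1?sym // setUC.
by case=> w; rewrite inE => evw ->; rewrite in_edge_set // !inE eqxx.
Qed.

Lemma cycle_edges_even e s : is_cycle e s -> even_set (cycle_edges s).
Proof.
case=> s3 us _ v.
(* Length at least 3 enters here: a vertex differs from its second successor, so different positions
   of [s] give different edges. *)
have nextne x : x \in s -> next s x != x /\ next s (next s x) != x.
  move=> xs; case: (rot_to xs) => i p def.
  rewrite -!(next_rot i us) def; move: us s3; rewrite -(rot_uniq i) -(size_rot i) def.
  case: p {def} => [|y [|z p]] //= /and3P[].
  rewrite !inE !negb_or => /and3P[xy xz _] /andP[yz _] _ _.
  by rewrite eqxx [y == x]eq_sym (negbTE xy) eqxx eq_sym xz; split; rewrite // eq_sym.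
have inj : {in [set x in s] &, injective (fun x => [set x; next s x])}.
  move=> x y; rewrite !inE => xs ys eq; apply/eqP/negPn/negP=> xy.
  have: x \in [set y; next s y] by rewrite -eq !inE eqxx.
  have: y \in [set x; next s x] by rewrite eq !inE eqxx.
  rewrite !inE eq_sym (negbTE xy) => /eqP ey /eqP ex.
  by have [_] := nextne x xs; rewrite -ey -ex eqxx.
have -> : deg (cycle_edges s) v = #|[set x in s | (v == x) || (v == next s x)]|.
  rewrite /deg -(card_in_imset (f := fun x => [set x; next s x])); last first.
    by move=> x y; rewrite !inE => /andP[xs _] /andP[ys _]; apply: inj; rewrite inE.
  apply: eq_card => A; rewrite inE; apply/andP/imsetP.
    by case=> /imsetP[x xs ->]; rewrite !inE => h; exists x; rewrite ?inE // xs.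
  case=> x; rewrite inE => /andP[xs h] ->; split; last by rewrite !inE.
  by apply/imsetP; exists x.
case vs: (v \in s); last first.
  rewrite (_ : [set _ in _ | _] = set0) ?cards0 //; apply/setP=> x; rewrite !inE.
  apply/negP=> /andP[xs /orP[]/eqP eq]; first by rewrite eq xs in vs.
  by rewrite eq mem_next xs in vs.
have pvs : prev s v \in s by rewrite mem_prev.
rewrite (_ : [set _ in _ | _] = [set v; prev s v]).
  rewrite cards2; have [+ _] := nextne _ pvs.
  by rewrite next_prev // => ->.
apply/setP=> x; rewrite !inE; apply/andP/orP.
  by case=> xs /orP[]/eqP ->; [left|right; rewrite prev_next].
by case=> /eqP ->; [rewrite eqxx | rewrite next_prev // eqxx orbT].
Qed.

(** A nonzero even degree is at least 2, so the end of a longest path in [F] has a second neighbour,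
    which closes a cycle with part of the path. *)
Lemma even_set_has_cycle e (F : {set {set 'I_n}}) : simple_graph e ->
  F \subset edge_set e -> F != set0 -> even_set F ->
  exists2 s, is_cycle e s & cycle_edges s \subset F.
Proof.
move=> sg sF F0 evF; have [irr sym] := sg.
pose f : rel 'I_n := fun u w => [set u; w] \in F.
have fe u w : f u w -> e u w by move=> /(subsetP sF); rewrite in_edge_set.
have fsym : symmetric f by move=> u w; rewrite /f setUC.
have two u w : f u w -> exists2 z, f u z & z != w.
  move=> fuw; have d2 : 1 < deg F u.
    have : 0 < deg F u by apply/deg_gt0P; exists [set u; w]; rewrite // !inE eqxx.
    by have := evF u; case: (deg F u) => [|[|d]].
  have [A] : exists A, A \in [set A in F | u \in A] :\ [set u; w].
    apply/set0Pn; rewrite -card_gt0; move: d2.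
    by rewrite /deg (cardsD1 [set u; w]) !inE eqxx [_ \in F]fuw.
  rewrite !inE => /and3P[nA AF uA].
  have /edge_setP[a [b [eab eA]]] := subsetP sF _ AF.
  have [z eAz] : exists z, A = [set u; z].
    by move: uA; rewrite eA !inE => /orP[]/eqP ->; [exists b|exists a; rewrite setUC].
  by exists z; [rewrite /f -eAz | apply: contraNneq nA => <-; rewrite eAz].
have [x0 [y0 fxy0]] : exists x y, f x y.
  by have /set0Pn[A AF] := F0; have /edge_setP[a [b [_ eA]]] := subsetP sF _ AF;
     exists a, b; rewrite /f -eA.
(* A longest path: both neighbours of its end lie on it. *)
pose P m := [exists p : m.-tuple 'I_n, (0 < m) && (if val p is x :: p' then path f x p' else false) && uniq p].
have exP : exists m, P m.
  exists 2; apply/existsP; exists [tuple x0; y0]; rewrite /= fxy0 !inE !andbT /=.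
  by apply/eqP=> eq; have := fe _ _ fxy0; rewrite eq irr.
have ubP m : P m -> m <= n.
  by case/existsP=> p /andP[_ up]; rewrite -[n]card_ord -(size_tuple p) -(card_uniqP up) max_card.
case: (ex_maxnP exP ubP) => m /existsP[[p /= sp]].
case: p sp => [|x p] sp; first by rewrite andbF.
rewrite -andbA => /and3P[m0 pth up] maxm.
have onp z : f x z -> z \in p.
  move=> fxz; apply/negPn/negP=> zp.
  suff: m.+1 <= m by rewrite ltnn.
  apply: maxm; apply/existsP.
  have sz : size [:: z, x & p] == m.+1 by rewrite /= eqSS.
  exists (Tuple sz) => /=; rewrite fsym fxz pth -/(uniq (x :: p)) up andbT /=.
  by rewrite inE negb_or zp !andbT; apply/eqP=> eq; have := fe _ _ fxz; rewrite eq irr.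
case: p sp pth up onp => [|y p] sp pth up onp.
  suff: 2 <= m by rewrite -(eqP sp).
  apply: maxm; apply/existsP; exists [tuple x0; y0]; rewrite /= fxy0 !inE !andbT /=.
  by apply/eqP=> eq; have := fe _ _ fxy0; rewrite eq irr.
have fxy : f x y by case/andP: pth.
have [z fxz zy] := two _ _ fxy.
have := onp z fxz; rewrite inE (negbTE zy) /= => zp.
case/splitPr: zp pth up {onp sp} => p1 p2 pth up.
(* The path is cut at the second neighbour [z] of [x]; as [z] differs from [y], at least three
   vertices remain. *)
exists [:: x, y & rcons p1 z].
  split=> //=.
  - by rewrite size_rcons.
  - move: up; rewrite /= mem_cat !(inE, mem_rcons) cat_uniq rcons_uniq /= !mem_cat !(inE, mem_rcons) !negb_or.
    by case/and5P=> /and4P[-> -> -> _] /and3P[-> -> _] -> /andP[-> _] _; rewrite !andbT.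
  - move: pth; rewrite /= cat_path /= => /and4P[h1 h2 h3 _].
    rewrite rcons_path last_rcons fe // rcons_path (sub_path fe) //=.
    by rewrite fe // fe // fsym.
apply/subsetP=> A /imsetP[w ws ->].
have cyc : cycle f [:: x, y & rcons p1 z].
  move: pth; rewrite /= cat_path /= => /and4P[h1 h2 h3 _].
  by rewrite h1 /= rcons_path last_rcons rcons_path h2 h3 fsym fxz.
exact: (next_cycle cyc).
Qed.

(** Each even set of a packing contains a cycle, and the edges of a cycle form an even set. Both
    inductions run over arbitrary edge sets, since [packs] shrinks its argument. *)
Lemma packs_cycles e k : simple_graph e ->
  packs k (edge_set e) <-> has_k_edge_disjoint_cycles e k.
Proof.
move=> sg; split.
- suff: forall E : {set {set 'I_n}}, E \subset edge_set e -> packs k E -> exists C : 'I_k -> seq 'I_n,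
    (forall i, is_cycle e (C i) /\ cycle_edges (C i) \subset E) /\
    (forall i j, i != j -> [disjoint cycle_edges (C i) & cycle_edges (C j)]).
    move=> H /(H _ (subxx _))[C [C1 C2]]; exists C; split=> // i.
    by case: (C1 i).
  elim: k => [|k IH] E sE /=; first by exists (fun=> [::]); split; case.
  case=> F [sFE F0 evF pF].
  have [s cs ss] := even_set_has_cycle sg (subset_trans sFE sE) F0 evF.
  have [C [C1 C2]] := IH (E :\: F) (subset_trans (subsetDl _ _) sE) pF.
  have dis i : [disjoint cycle_edges s & cycle_edges (C i)].
    rewrite disjoint_sym; apply: disjointWr ss _; apply: disjointWl (C1 i).2 _.
    by rewrite -setI_eq0 setIDAC setDIl setDv setI0.
  exists (fun i => if unlift ord0 i is Some j then C j else s); split=> [i|i j].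
    case: unliftP => [j _|_]; last by split=> //; apply: subset_trans ss sFE.
    by case: (C1 j) => h1 h2; split=> //; apply: subset_trans h2 (subsetDl _ _).
  case: (unliftP ord0 i) => [i' ->|->]; case: (unliftP ord0 j) => [j' ->|->]; rewrite ?eqxx //.
    by move=> ij; apply: C2; apply: contraNneq ij => ->.
  by rewrite disjoint_sym.
- case=> C [C1 C2].
  have: forall i, cycle_edges (C i) \subset edge_set e.
    move=> i; apply/subsetP=> A /imsetP[x xs ->]; case: (C1 i) => _ _ cyc.
    by rewrite in_edge_set; [apply: (next_cycle cyc) | case: sg].
  move: (edge_set e) => E; elim: k E C C1 C2 => //= k IH E C C1 C2 sC.
  exists (cycle_edges (C ord0)); split=> //.
  + have [+ _ _] := C1 ord0; case: (C ord0) => // x s _.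
    by apply/set0Pn; exists [set x; next (x :: s) x]; apply/imsetP; exists x; rewrite ?inE ?eqxx.
  + exact: cycle_edges_even (C1 ord0).
  + apply: (IH _ (fun i => C (lift ord0 i))) => // [i j ij|i].
      by apply: C2; rewrite (inj_eq (@lift_inj _ _)).
    by rewrite subsetD sC C2.
Qed.

End Cycles.

(** * Finding edge-disjoint even sets *)

(** In the case of minimum degree 3 of [packs_excess] the left side bounds the number of vertices;
    the exponent [i = 4 * k + 2] then gives an even set with at most [i.*2 = 8 * k + 4] edges. *)
Lemma excess_arith k : 2 * (4 * k.+1 ^ 2 - 3) < 2 ^ (4 * k + 2).
Proof.
have -> : 2 ^ (4 * k + 2) = 4 * 16 ^ k by rewrite expnD expnM mulnC.
suff: 2 * (4 * k.+1 ^ 2) < 4 * 16 ^ k + 6 by have : 0 < k.+1 ^ 2; [rewrite expn_gt0 | lia].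
elim: k => // k; rewrite (expnS 16); have : 0 < 16 ^ k by rewrite expn_gt0.
by move: (16 ^ k) => x; rewrite -!mulnn; nia.
Qed.

Section Packings.
Variable T : finType.
Implicit Types (E F G H : {set {set T}}) (A V : {set T}) (a b c r u v w z : T).

Lemma eq_set2 a b c d :
  ([set a; b] == [set c; d]) = ((a == c) && (b == d)) || ((a == d) && (b == c)).
Proof.
apply/eqP/idP => [eq|/orP[]/andP[/eqP-> /eqP->]] //; last exact: setUC.
have: a \in [set c; d] by rewrite -eq !inE eqxx.
have: b \in [set c; d] by rewrite -eq !inE eqxx orbT.
have: c \in [set a; b] by rewrite eq !inE eqxx.
have: d \in [set a; b] by rewrite eq !inE eqxx orbT.
rewrite !inE [c == a]eq_sym [d == b]eq_sym [d == a]eq_sym [c == b]eq_sym.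
by case: (a == c); case: (b == c); case: (a == d); case: (b == d).
Qed.

Lemma deg0 v : deg set0 v = 0.
Proof. by apply/eqP; rewrite cards_eq0 -subset0; apply/subsetP=> A; rewrite !inE. Qed.

Lemma deg_setU1 A F v : A \notin F -> deg (A |: F) v = (v \in A) + deg F v.
Proof.
move=> AF; rewrite /deg; case vA: (v \in A).
  rewrite (_ : [set _ in _ | _] = A |: [set A in F | v \in A]).
    by rewrite cardsU1 !inE (negbTE AF).
  by apply/setP=> B; rewrite !inE; case: eqP => // ->; rewrite vA.
by apply: eq_card => B; rewrite !inE; case: eqP => // ->; rewrite vA !andbF.
Qed.

Lemma card_avoid E v : #|E| = #|[set A in E | v \notin A]| + deg E v.
Proof.
rewrite -(cardsID [set A : {set T} | v \in A] E) addnC; congr (_ + _).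
  by apply: eq_card => A; rewrite !inE andbC.
by apply: eq_card => A; rewrite !inE.
Qed.

(** For distinct vertices this is the set of the three edges; the form with [symd] lets evenness
    follow from additivity of degree parities. *)
Definition triangle a b c := symd [set [set a; b]] (symd [set [set b; c]] [set [set c; a]]).

Lemma even_triangle a b c : a != b -> b != c -> c != a -> even_set (triangle a b c).
Proof.
move=> ab bc ca v; rewrite !odd_deg_symd !deg_edge //.
by rewrite ![v == _]eq_sym; case: (a == v); case: (b == v); case: (c == v).
Qed.

Lemma in_triangle a b c A : A \in triangle a b c ->
  [|| A == [set a; b], A == [set b; c] | A == [set c; a]].
Proof. by rewrite !in_symd !inE; case: (_ == _); case: (_ == _); case: (_ == _). Qed.

Lemma triangle_mem a b c : a != b -> b != c -> c != a ->
  [set a; b] \in triangle a b c.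
Proof.
move=> ab bc ca; rewrite !in_symd !inE eqxx !eq_set2 eqxx.
by rewrite (negbTE ab) [a == c]eq_sym (negbTE ca) (negbTE bc) !andbF.
Qed.

Lemma card_triangle a b c : #|triangle a b c| <= 3.
Proof.
by apply: leq_trans (card_symd _ _) _; rewrite cards1 ltnS;
   apply: leq_trans (card_symd _ _) _; rewrite !cards1.
Qed.

(** * A Moore bound: growth of spheres when there is no short even set *)

Section Moore.
Variables (E : {set {set T}}) (g : nat) (r : T).
Hypothesis gE : forall A, A \in E -> #|A| = 2.
Hypothesis no_short : forall F, F \subset E -> even_set F -> #|F| <= g -> F = set0.

(** The boundary of [F] modulo 2 is [u + w]; for [u = w] this says that [F] is even. *)
Let joins F u w := forall z, odd (deg F z) = (z == u) (+) (z == w).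

(** The symmetric difference of two joins with the same ends is even and has at most [g] edges,
    hence is empty. *)
Lemma joins_uniq F G u w : F \subset E -> G \subset E -> joins F u w -> joins G u w ->
  #|F| + #|G| <= g -> F = G.
Proof.
move=> sF sG jF jG cFG.
have /setP e0 : symd F G = set0.
  apply: no_short; first exact: symd_sub.
    by move=> z; rewrite odd_deg_symd jF jG addbb.
  exact: leq_trans (card_symd _ _) cFG.
by apply/setP=> A; have := e0 A; rewrite in_symd inE; case: (A \in F); case: (A \in G).
Qed.

(* Parity version of "F is a path with i edges from r to u". *)
Definition is_join i u F :=
  [/\ F \subset E, #|F| = i, joins F r u, deg F u <= 1 &
      forall z, 0 < deg F z -> exists2 F' : {set {set T}}, F' \subset F & joins F' z u].

(** If [z] were already on [F], the part of [F] from [z] to [u] and the single edge [[set u; z]]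
    would be two joins with at most [g] edges in total, hence equal, although this edge is not in
    [F]. *)
Lemma join_extend i u z F : i < g -> is_join i u F ->
  [set u; z] \in E :\: F -> deg F z = 0 /\ is_join i.+1 z ([set u; z] |: F).
Proof.
move=> ig [sF cF jF dF tF]; rewrite inE => /andP[nF uzE].
have uz : u != z by have := gE uzE; rewrite cards2; case: (u == z).
have dz : deg F z = 0.
  apply/eqP; rewrite -leqn0 leqNgt; apply/negP=> /tF[F' sF' jF'].
  have eF' : F' = [set [set u; z]].
    apply: (@joins_uniq _ _ z u) => //.
    - exact: subset_trans sF' sF.
    - by rewrite sub1set.
    - by move=> y; rewrite deg_edge // addbC.
    - by rewrite cards1 addn1; apply: leq_ltn_trans (subset_leq_card sF') _; rewrite cF.
  by move/negP: nF; apply; apply: (subsetP sF'); rewrite eF' set11.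
have eqU : [set u; z] |: F = symd [set [set u; z]] F.
  by apply/setP=> A; rewrite in_symd !inE; case: eqP => // ->; rewrite (negbTE nF).
split=> //; split.
- by rewrite subUset sub1set uzE.
- by rewrite cardsU1 nF cF.
- move=> y; rewrite eqU odd_deg_symd deg_edge // jF.
  by case: (y == u); case: (y == z); case: (y == r).
- by rewrite deg_setU1 // dz !inE eqxx orbT.
- move=> y; rewrite deg_setU1 // !inE => dy.
  have [->|yz] := eqVneq y z.
    by exists set0; rewrite ?sub0set // => x; rewrite deg0 addbb.
  have [->|yu] := eqVneq y u.
    by exists [set [set u; z]]; rewrite ?subsetUl // => x; rewrite deg_edge.
  move: dy; rewrite (negbTE yz) (negbTE yu) => /tF[F' sF' jF'].
  exists (symd [set [set u; z]] F').
    by apply: symd_sub; rewrite ?subsetUl //; apply: subset_trans sF' (subsetUr _ _).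
  move=> x; rewrite odd_deg_symd deg_edge // jF'.
  by case: (x == u); case: (x == z); case: (x == y).
Qed.

Variable V : {set T}.
Hypothesis sV : forall A, A \in E -> A \subset V.
Hypothesis d3 : forall v, v \in V -> 3 <= deg E v.
Hypothesis rV : r \in V.

(* Two vertices reached after [i] steps cannot share a new neighbour, so the
   spheres around [r] double in size. *)
Lemma joins_reach i : i.*2 <= g -> exists X : {set T},
  [/\ X \subset V, 2 ^ i <= #|X| & forall u, u \in X -> exists F, is_join i u F].
Proof.
elim: i => [|i IH] ig.
  exists [set r]; split; rewrite ?sub1set ?cards1 // => u /set1P ->; exists set0.
  split; rewrite ?sub0set ?cards0 ?deg0 // => z; rewrite deg0 //.
  by rewrite addbb.
have [|X [sX cX jX]] := IH; first by apply: leq_trans ig; rewrite leq_double.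
have /fin_all_exists[F jF] : forall u, exists F, u \in X -> is_join i u F.
  move=> u; case uX: (u \in X); last by exists set0.
  by have [F jF] := jX u uX; exists F.
(* [N u] is empty for [u] outside [X], so the union of these sets can run over all vertices. *)
pose N u := [set z | (u \in X) && ([set u; z] \in E :\: F u)].
have ltig : i < g by lia.
have ext u z : z \in N u -> deg (F u) z = 0 /\ is_join i.+1 z ([set u; z] |: F u).
  by rewrite inE => /andP[uX h]; apply: join_extend => //; apply: jF.
have disN u w : u != w -> [disjoint N u & N w].
  (* The two joins ending in [z] have [i.+1.*2 <= g] edges together, so they coincide; then [F u]
     would contain [[set w; z]], although [z] has degree 0 in [F u]. *)
  move=> uw; rewrite -setI_eq0 -subset0; apply/subsetP=> z; rewrite inE => /andP[zu zw].
  have [du [su cu ju _ _]] := ext _ _ zu; have [dw [sw cw jw _ _]] := ext _ _ zw.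
  have eq : [set u; z] |: F u = [set w; z] |: F w.
    by apply: joins_uniq ju jw _ => //; rewrite cu cw addnn.
  have : [set w; z] \in [set u; z] |: F u by rewrite eq setU11.
  rewrite !inE eq_set2 eqxx andbT eq_sym (negbTE uw) /=.
  case/orP=> [/andP[/eqP wz /eqP zu']|h]; first by rewrite -zu' wz eqxx in uw.
  have : 0 < deg (F u) z by apply/deg_gt0P; exists [set w; z]; rewrite ?set22.
  by rewrite du.
exists (\bigcup_u N u); split.
- apply/bigcupsP=> u _; apply/subsetP=> z; rewrite !inE => /and3P[_ _ /sV/subsetP]; apply.
  by rewrite !inE eqxx orbT.
- rewrite -sum1_card partition_disjoint_bigcup //.
  rewrite (bigID (mem X)) /=.
  apply: leq_trans (leq_addr _ _).
  rewrite expnS mulnC; apply: (@leq_trans (\sum_(u in X) 2)).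
    by rewrite sum_nat_const leq_mul2r cX.
  apply: leq_sum => u uX; rewrite sum1_card.
  have [_ _ _ du _] := jF u uX.
  (* [F u] takes at most one of the three or more edges at [u], so at least two lead into [N u]. *)
  suff : deg E u <= #|N u| + deg (F u) u by have := d3 (subsetP sX _ uX); lia.
  rewrite -(card_in_imset (f := fun z => [set u; z]) (D := N u)); last first.
    move=> z1 z2; rewrite !inE => _ _ /eqP; rewrite eq_set2 eqxx /=.
    by case/orP=> [/eqP|/andP[/eqP-> /eqP]].
  apply: leq_trans (leq_card_setU _ _); apply/subset_leq_card/subsetP=> A.
  rewrite !inE => /andP[AE uA]; rewrite uA andbT.
  case AF: (A \in F u); first by rewrite orbT.
  rewrite orbF; have /cards2P[x [y [xy eA]]] : #|A| == 2 by rewrite gE.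
  have [z eAz] : exists z, A = [set u; z].
    by move: uA; rewrite eA !inE => /orP[]/eqP ->; [exists y|exists x; rewrite setUC].
  by apply/imsetP; exists z; rewrite // !inE -eAz uX AF AE.
- by move=> z /bigcupP[u _ /ext[_ j]]; exists ([set u; z] |: F u).
Qed.

End Moore.

(** Without such an [F], the sphere of radius [i] around a vertex of [V] would have at least [2 ^ i]
    elements, more than [V] has. *)
Lemma short_even_set E V i : (forall A, A \in E -> #|A| = 2) ->
  (forall A, A \in E -> A \subset V) -> (forall v, v \in V -> 3 <= deg E v) ->
  V != set0 -> #|V| < 2 ^ i ->
  exists F, [/\ F \subset E, F != set0, even_set F & #|F| <= i.*2].
Proof.
move=> gE sV d3 /set0Pn[r rV] cV.
have [/existsP[F /and4P[h1 h2 /forallP h3 h4]]|/existsPn no] :=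
  boolP [exists F : {set {set T}}, [&& F \subset E, F != set0, [forall v, ~~ odd (deg F v)] & #|F| <= i.*2]].
  by exists F.
have ns F : F \subset E -> even_set F -> #|F| <= i.*2 -> F = set0.
  move=> h1 h2 h3; apply/eqP; have := no F; rewrite h1 h3 andbT /=.
  have -> : [forall v, ~~ odd (deg F v)] by apply/forallP.
  by rewrite andbT; case: (F == set0).
have [X [sX cX _]] := joins_reach gE ns sV d3 rV (leqnn _).
by have := leq_trans cV (leq_trans cX (subset_leq_card sX)); rewrite ltnn.
Qed.

(** An even set through the edge [[set a; b]] is rerouted through [v] by adding the triangle [v a b]
    modulo 2; the other sets do not use that edge and stay as they are. *)
Lemma packs_subdivide k H a b v : a != b -> v != a -> v != b ->
  (forall A, A \in H -> v \notin A) -> [set a; b] \notin H ->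
  packs k ([set a; b] |: H) -> packs k ([set v; a] |: ([set v; b] |: H)).
Proof.
move=> ab va vb; elim: k H => //= k IH H vH abH [F [sF F0 evF pF]].
have vF A : A \in F -> v \notin A.
  move/(subsetP sF); rewrite !inE => /orP[/eqP ->|/vH//].
  by rewrite !inE negb_or va vb.
case abF: ([set a; b] \in F); last first.
  have sFH : F \subset H.
    apply/subsetP=> A AF; have := subsetP sF _ AF; rewrite !inE => /orP[/eqP eA|//].
    by rewrite -eA AF in abF.
  exists F; split=> //; first by apply: subset_trans sFH _; rewrite setUA subsetUr.
  have: packs k ([set v; a] |: ([set v; b] |: (H :\: F))).
    apply: IH; first by move=> A; rewrite inE => /andP[_ /vH].
      by rewrite inE negb_and abH orbT.
    apply: packs_sub pF; apply/subsetP=> A; rewrite !inE.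
    by case: (A \in F).
  apply: packs_sub; apply/subsetP=> A; rewrite !inE.
  case AF: (A \in F) => //=; rewrite orbF => /orP[]/eqP eA; have := vF _ AF.
    by rewrite eA !inE eqxx.
  by rewrite eA !inE eqxx.
have tri := even_triangle va ab; rewrite eq_sym in vb; have {}tri := tri vb.
have trivab A : A \in triangle v a b -> A != [set a; b] -> A \in [set v; a] |: ([set v; b] |: H).
  by move/in_triangle; rewrite !inE [[set b; v]]setUC; case: (A == _); case: (A == _); case: (A == _).
have abtri : [set a; b] \in triangle v a b.
  rewrite !in_symd !inE eqxx !eq_set2 eqxx.
  by rewrite (negbTE ab) [a == v]eq_sym (negbTE va) (negbTE vb) [b == a]eq_sym (negbTE ab) !andbF.
exists (symd F (triangle v a b)); split.
- apply/subsetP=> A; rewrite in_symd.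
  have [->|nA] := eqVneq A [set a; b]; first by rewrite abF abtri.
  case AF: (A \in F) => /=; last by move/trivab; apply.
  by have := subsetP sF _ AF; rewrite !inE (negbTE nA) /= => ->; rewrite !orbT.
- apply/set0Pn; exists [set v; a]; rewrite in_symd triangle_mem //.
  by rewrite addbT; apply/negP=> /vF; rewrite !inE eqxx.
- exact: even_symd.
- apply: packs_sub pF; apply/subsetP=> A; rewrite !in_setD in_symd !in_setU1 => /andP[AF].
  have [eA|nA /= AH] := eqVneq A [set a; b]; first by rewrite -eA (negbTE AF) in abF.
  rewrite (negbTE AF) AH !orbT andbT /=.
  apply/negP=> /in_triangle; rewrite (negbTE nA) /= => /orP[]/eqP eA;
  by have := vH _ AH; rewrite eA !inE eqxx ?orbT.
Qed.

(* From [k >= 1] to [k + 1] the bound [4k^2 - 3] grows by [8k + 4], the size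
   allowed for a short even set; at [k = 0] it is truncated to 0. *)
Lemma packs_excess k V E : (forall A, A \in E -> #|A| = 2) ->
  (forall A, A \in E -> A \subset V) -> #|V| + (4 * k ^ 2 - 3) <= #|E| -> packs k E.
Proof.
elim: k V E => // k IHk V E.
have [m] := ubnP (#|V| + #|E|); elim: m V E => // m IH V E; rewrite ltnS => mVE gE sV cE.
(* Any even set this short can be taken first: the rest still satisfies the bound for [k], and when
   [k = 0] one set suffices. *)
have step F : F \subset E -> F != set0 -> even_set F -> #|F| <= 8 * k + 4 -> packs k.+1 E.
  move=> sF F0 evF cF; exists F; split=> //; have [->|k0] := posnP k; first by [].
  apply: (IHk V); try by move=> A; rewrite inE => /andP[_]; auto.
  have := cardsD E F; rewrite (setIidPr sF) => ->.
  by move: cE cF k0; rewrite -!mulnn; nia.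
(* A surplus edge can be deleted, so equality may be assumed. *)
have [lt|ge] := ltnP (#|V| + (4 * k.+1 ^ 2 - 3)) #|E|.
  have /set0Pn[A AE] : E != set0 by rewrite -card_gt0; apply: leq_ltn_trans lt.
  apply: packs_sub (subD1set E A) _; have cA := cardsD1 A E; rewrite AE in cA.
  apply: (IH V); try by move=> B; rewrite inE => /andP[_]; auto.
    by lia.
  by lia.
have {ge cE}cE : #|E| = #|V| + (4 * k.+1 ^ 2 - 3) by apply/eqP; rewrite eqn_leq ge cE.
have [/existsP[v /andP[vV dv]]|/existsPn d3] := boolP [exists v, (v \in V) && (deg E v <= 2)]; last first.
  have {}d3 v : v \in V -> 3 <= deg E v by move=> vV; have := d3 v; rewrite vV -ltnNge.
  have V0 : V != set0.
    have /set0Pn[A AE] : E != set0.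
      by rewrite -card_gt0 cE; have h : 0 < k.+1 ^ 2; [by rewrite expn_gt0 | lia].
    apply/negP=> /eqP V0; have := sV _ AE; rewrite V0 subset0 => /eqP A0.
    by have := gE _ AE; rewrite A0 cards0.
  (* The degree sum gives [3 * #|V| <= 2 * #|E|], and the equality [cE] turns this into
     [#|V| <= 2 * (4 * k.+1 ^ 2 - 3)]. *)
  have cV : #|V| < 2 ^ (4 * k + 2).
    apply: leq_ltn_trans (excess_arith k).
    suff : 3 * #|V| <= (#|E|).*2 by lia.
    rewrite -sum_deg // (bigID (mem V)) /= mulnC -sum_nat_const.
    by apply: leq_trans (leq_addr _ _); apply: leq_sum.
  have [F [h1 h2 h3 h4]] := short_even_set gE sV d3 V0 cV.
  by apply: step h1 h2 h3 _; lia.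
have cav := card_avoid E v; set H := [set A in E | v \notin A] in cav.
have HE : H \subset E by apply/subsetP=> A; rewrite inE => /andP[].
have sVH A : A \in H -> A \subset V :\ v.
  by rewrite inE => /andP[AE vA]; rewrite subsetD1 vA sV.
have cVv : #|V| = (#|V :\ v|).+1 by rewrite (cardsD1 v V) vV.
(* Deleting such a [v] costs one vertex and at most one edge. *)
have [d1|d2] := leqP (deg E v) 1.
  apply: (packs_sub HE); apply: (IH (V :\ v)) => //; last by lia.
    by lia.
  by move=> A /(subsetP HE); auto.
have {d2 dv}dv : deg E v = 2 by lia.
have /cards2P[A1 [A2 [neA eA]]] : #|[set A in E | v \in A]| == 2 by rewrite -dv.
have nbr A : A \in [set A in E | v \in A] -> exists2 a, v != a & A = [set v; a].
  rewrite inE => /andP[AE vA]; have /cards2P[x [y [xy e]]] : #|A| == 2 by rewrite gE.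
  move: vA; rewrite e !inE => /orP[]/eqP ->; first by exists y.
  by exists x; [rewrite eq_sym | rewrite setUC].
have [a va eA1] : exists2 a, v != a & A1 = [set v; a] by apply: nbr; rewrite eA set21.
have [b vb eA2] : exists2 b, v != b & A2 = [set v; b] by apply: nbr; rewrite eA set22.
have vaE : [set v; a] \in E by have := set21 A1 A2; rewrite -eA -eA1 inE => /andP[].
have vbE : [set v; b] \in E by have := set22 A1 A2; rewrite -eA -eA2 inE => /andP[].
have ab : a != b by apply: contraNneq neA => ab; rewrite eA1 eA2 ab.
(* If the two neighbours of [v] are adjacent, the triangle is short enough for [step]. Otherwise [v]
   is replaced by the edge [[set a; b]], which lowers both counts by one. *)
have [abE|abE] := boolP ([set a; b] \in E).
  have bv : b != v by rewrite eq_sym.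
  apply: (step (triangle v a b)).
  - by apply/subsetP=> A /in_triangle /or3P[]/eqP ->; rewrite // setUC.
  - by apply/set0Pn; exists [set v; a]; apply: triangle_mem.
  - exact: even_triangle.
  - by apply: leq_trans (card_triangle _ _ _) _; lia.
have abH : [set a; b] \notin H by apply: contra abE => /(subsetP HE).
have: packs k.+1 ([set a; b] |: H).
  apply: (IH (V :\ v)).
  - by rewrite cardsU1 abH; lia.
  - by move=> A; rewrite !inE => /orP[/eqP->|/andP[/gE//]]; rewrite cards2 ab.
  - move=> A; rewrite in_setU1 => /orP[/eqP->|]; last exact: sVH.
    rewrite subUset !sub1set !inE ![_ == v]eq_sym va vb /=.
    by have := sV _ vaE; have := sV _ vbE; rewrite !subUset !sub1set => /andP[_ ->] /andP[_ ->].
  - by rewrite cardsU1 abH; lia.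
move/(packs_subdivide ab va vb)=> p.
apply: packs_sub (p _ abH); last by move=> A; rewrite inE => /andP[].
by rewrite !subUset !sub1set vaE vbE.
Qed.

(** Two common neighbours [a] and [b] form a 4-cycle with [v] and [w]; disjoint pairs in [W] give
    edge-disjoint 4-cycles. *)
Lemma packs_codeg k E v w (W : {set T}) : v != w -> v \notin W -> w \notin W ->
  (forall u, u \in W -> [set v; u] \in E /\ [set w; u] \in E) ->
  k.*2 <= #|W| -> packs k E.
Proof.
move=> vw; elim: k W E => //= k IH W E vW wW WE; rewrite doubleS => cW.
have /set0Pn[a aW] : W != set0 by rewrite -card_gt0; lia.
have cWa := cardsD1 a W; rewrite aW in cWa.
have /set0Pn[b] : W :\ a != set0 by rewrite -card_gt0; lia.
have cWb := cardsD1 b (W :\ a).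
move=> bW; rewrite bW in cWb; have {cW}cW : k.*2 <= #|W :\ a :\ b|.
  by move: cW; rewrite cWa cWb !add1n !ltnS.
move: bW {cWa cWb}; rewrite !inE => /andP[ba bW].
have neW x : x \in W -> (v != x) /\ (w != x).
  by move=> xW; split; [apply: contraNneq vW => -> | apply: contraNneq wW => ->].
have [[va wa] [vb wb]] := (neW _ aW, neW _ bW).
have [[vaE waE] [vbE wbE]] := (WE _ aW, WE _ bW).
pose F := symd (symd [set [set v; a]] [set [set w; a]]) (symd [set [set v; b]] [set [set w; b]]).
have inF A : A \in F -> exists2 x, x \in [set a; b] & (A = [set v; x]) \/ (A = [set w; x]).
  rewrite !in_symd !inE => h.
  have : [|| A == [set v; a], A == [set w; a], A == [set v; b] | A == [set w; b]].
    by move: h; do 4 case: (A == _).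
  case/or4P=> /eqP ->; [exists a|exists a|exists b|exists b]; rewrite ?set21 ?set22 //; auto.
exists F; split.
- apply/subsetP=> A /inF[x]; rewrite !inE => /orP[]/eqP -> [] -> //.
- apply/set0Pn; exists [set v; a]; rewrite !in_symd !inE !eq_set2 !eqxx.
  by rewrite (negbTE vw) [a == w]eq_sym [a == b]eq_sym (negbTE wa) (negbTE ba) (negbTE vb) /= ?andbF.
- move=> x; rewrite !odd_deg_symd !deg_edge //.
  by case: (x == v); case: (x == w); case: (x == a); case: (x == b).
apply: (IH (W :\ a :\ b)); last exact: cW.
- by rewrite !inE (negbTE vW) !andbF.
- by rewrite !inE (negbTE wW) !andbF.
move=> u; rewrite !in_setD1 => /and3P[ub ua uW]; have [vuE wuE] := WE _ uW.
have [vu wu] := neW _ uW.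
rewrite !in_setD vuE wuE !andbT; split; apply/negP=> /inF[x]; rewrite !inE => xab [] /eqP;
  rewrite eq_set2 ?(eqxx v) ?(eqxx w) => /orP[]/andP[/eqP e1 /eqP e2]; subst;
  by move: xab vu wu; rewrite ?(negbTE ua) ?(negbTE ub) ?eqxx.
Qed.

(** Greedy choice: each edge of [H] closes a triangle with [v], and discarding the at most [2 * d]
    edges of [H] that meet it leaves only edges whose triangles are disjoint from it. *)
Lemma packs_triangles k d E H v : H \subset E -> (forall A, A \in H -> #|A| = 2) ->
  (forall A u, A \in H -> u \in A -> v != u /\ [set v; u] \in E) ->
  (forall u, deg H u <= d) -> 2 * d * k < #|H| -> packs k.+1 E.
Proof.
elim: k E H => [|k IH] E H sH gH HE dH cH.
all: have /set0Pn[A AH] : H != set0 by rewrite -card_gt0; apply: leq_ltn_trans cH.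
all: have /cards2P[a [b [ab eA]]] : #|A| == 2 by rewrite gH.
all: have [va vaE] := HE _ a AH ltac:(by rewrite eA set21).
all: have [vb vbE] := HE _ b AH ltac:(by rewrite eA set22).
all: have bv : b != v by rewrite eq_sym.
all: exists (triangle v a b); split; first (by
  apply/subsetP=> B /in_triangle/or3P[]/eqP ->; rewrite 1?[[set b; v]]setUC // -eA (subsetP sH)).
all: try by apply/set0Pn; exists [set v; a]; apply: triangle_mem.
all: try exact: even_triangle.
  by [].
pose H' := [set B in [set B in H | a \notin B] | b \notin B].
have sH' : H' \subset H by apply/subsetP=> B; rewrite !inE -andbA => /and3P[].
have HD B : B \in H' -> [/\ B \in H, a \notin B & b \notin B].
  by rewrite !inE -andbA => /and3P[].
apply: (IH _ H').
- apply/subsetP=> B /HD[BH aB bB]; rewrite inE (subsetP sH) // andbT.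
  by apply/negP=> /in_triangle/or3P[]/eqP eB; move: aB bB; rewrite eB !inE !eqxx ?orbT.
- by move=> B /HD[/gH].
- move=> B u /HD[BH aB bB] uB; have [vu vuE] := HE _ _ BH uB; split=> //.
  rewrite inE vuE andbT; apply/negP=> /in_triangle.
  have ua : u != a by apply: contraNneq aB => <-.
  have ub : u != b by apply: contraNneq bB => <-.
  by rewrite !eq_set2 (negbTE ua) (negbTE ub) (negbTE va) (eq_sym v b) (negbTE bv) !andbF.
- by move=> u; apply: leq_trans (deg_sub _ sH') (dH u).
- have c1 := card_avoid H a; have c2 := card_avoid [set B in H | a \notin B] b.
  have := dH a; have : deg [set B in H | a \notin B] b <= d.
    by apply: leq_trans (dH b); apply: deg_sub; apply/subsetP=> B; rewrite inE => /andP[].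
  by rewrite -/H' in c2; nia.
Qed.

End Packings.

(** * The Perron vector *)

Section Spectrum.
Import classical_sets topology normedtype derive.
Import numFieldNormedType.Exports.
Import Order.TTheory GRing.Theory Num.Theory.
Local Open Scope ring_scope.

Variables (R : realType) (n : nat).
Implicit Types (e : rel 'I_n) (x y z : 'I_n -> R) (i j : 'I_n).

(** With $A$ the adjacency matrix, [nbsum e x] is $Ax$ and [qform e x] is $x^T A x$; vectors are
    kept as functions on vertices. *)
Definition nbsum e x i : R := \sum_(j | e i j) x j.

Definition qform e x : R := \sum_i x i * nbsum e x i.

Definition sqnorm x : R := \sum_i x i ^+ 2.

Lemma nbsumD e x z (t : R) i :
  nbsum e (fun j => x j + t * z j) i = nbsum e x i + t * nbsum e z i.
Proof. by rewrite /nbsum big_split /= mulr_sumr. Qed.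

Lemma nbsum_sym e x z : symmetric e ->
  \sum_i x i * nbsum e z i = \sum_i z i * nbsum e x i.
Proof.
move=> sym; rewrite /nbsum; under eq_bigr do rewrite mulr_sumr.
rewrite (exchange_big_dep xpredT) //=; apply: eq_bigr => j _; rewrite mulr_sumr.
by apply: eq_big => [i|i _]; [rewrite sym | rewrite mulrC].
Qed.

Lemma qform_line e x z (t : R) : symmetric e ->
  qform e (fun j => x j + t * z j) =
  qform e x + 2 * t * (\sum_i z i * nbsum e x i) + t ^+ 2 * qform e z.
Proof.
move=> sym; rewrite /qform; under eq_bigr do rewrite nbsumD mulrDl !mulrDr.
rewrite !big_split /= -addrA.
have -> : \sum_i x i * (t * nbsum e z i) = t * \sum_i z i * nbsum e x i.
  by rewrite -nbsum_sym // mulr_sumr; apply: eq_bigr => i _; ring.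
have -> : \sum_i t * z i * nbsum e x i = t * \sum_i z i * nbsum e x i.
  by rewrite mulr_sumr; apply: eq_bigr => i _; ring.
have -> : \sum_i t * z i * (t * nbsum e z i) = t ^+ 2 * \sum_i z i * nbsum e z i.
  by rewrite mulr_sumr; apply: eq_bigr => i _; ring.
by ring.
Qed.

Lemma sqnorm_line x z (t : R) :
  sqnorm (fun j => x j + t * z j) =
  sqnorm x + 2 * t * (\sum_i z i * x i) + t ^+ 2 * sqnorm z.
Proof.
rewrite /sqnorm !mulr_sumr -!big_split /=.
by apply: eq_bigr => i _; ring.
Qed.

Lemma sqnorm_ge0 x : 0 <= sqnorm x.
Proof. by apply: sumr_ge0 => i _; apply: sqr_ge0. Qed.

Lemma sqnorm_eq0 x : sqnorm x = 0 -> forall i, x i = 0.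
Proof.
move/eqP; rewrite psumr_eq0; last by move=> i _; apply: sqr_ge0.
by move/allP=> h i; have := h i (mem_index_enum _); rewrite sqrf_eq0 => /eqP.
Qed.

Lemma sqnorm_gt0 x i : x i != 0 -> 0 < sqnorm x.
Proof.
move=> xi; rewrite lt0r sqnorm_ge0 andbT; apply: contra_neq xi => h.
exact: sqnorm_eq0 h i.
Qed.

(* The form [rho |x|^2 - qform x] is nonnegative, so its gradient vanishes
   wherever the form does. *)
Lemma maximizer_eigen e x (rho : R) : symmetric e ->
  (forall y, qform e y <= rho * sqnorm y) -> rho * sqnorm x <= qform e x ->
  forall i, nbsum e x i = rho * x i.
Proof.
move=> sym ub hx; pose z i := nbsum e x i - rho * x i.
suff : sqnorm z = 0.
  by move=> /sqnorm_eq0 h i; have := h i; rewrite /z => /eqP; rewrite subr_eq0 => /eqP.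
(* The bound at [x + t * z] is expanded; the terms without [t] cancel by [hx], and the rest is
   divided by [t]. *)
have key t : 0 < t -> 2 * sqnorm z <= t * (rho * sqnorm z - qform e z).
  move=> t0; have := ub (fun j => x j + t * z j).
  rewrite qform_line // sqnorm_line => h.
  have hz : \sum_i z i * nbsum e x i - rho * \sum_i z i * x i = sqnorm z.
    rewrite mulr_sumr -sumrB; apply: eq_bigr => i _; rewrite {2 3}/z; rewrite /z; ring.
  rewrite -(ler_pM2l t0).
  move: (\sum_i z i * nbsum e x i) (\sum_i z i * x i) hz h => p q hz h.
  by rewrite -{1}hz; nra.
apply/eqP; rewrite eq_le sqnorm_ge0 andbT leNgt; apply/negP=> z0.
set w := rho * sqnorm z - qform e z in key.
have [w0|w0] := leP w 0; first by have := key 1 ltr01; nra.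
(* This [t] makes the right side of [key] equal to [sqnorm z], half of the left side. *)
have := key (sqnorm z / w) (divr_gt0 z0 w0).
by rewrite divfK ?gt_eqF //; nra.
Qed.

Lemma eigenvalue_adj e (mu : R) : symmetric e ->
  reflect (exists2 x, (exists i, x i != 0) & forall i, nbsum e x i = mu * x i)
          (eigenvalue (adj_mx R e) mu).
Proof.
move=> sym; have nbE (v : 'rV[R]_n) j : (v *m adj_mx R e) ord0 j = nbsum e (v ord0) j.
  rewrite mxE /nbsum [RHS]big_mkcond /=; apply: eq_bigr => i _.
  by rewrite mxE sym; case: (e j i); rewrite ?mulr1 ?mulr0.
apply: (iffP eigenvalueP) => [[v hv v0]|[x [i xi] hx]].
  exists (v ord0); last by move=> i; rewrite -nbE hv mxE.
  have /rV0Pn[i vi] := v0; by exists i.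
exists (\row_i x i); last by apply/rV0Pn; exists i; rewrite mxE.
apply/rowP=> j; rewrite nbE !mxE -hx; apply: eq_bigr => k _; by rewrite mxE.
Qed.

(** The last clause makes [rho] the maximum of the Rayleigh quotient, so radii of different graphs
    can be compared through test vectors. *)
Definition is_perron e (rho : R) x :=
  [/\ forall i, 0 <= x i, exists i, 0 < x i, forall i, nbsum e x i = rho * x i &
      forall y, qform e y <= rho * sqnorm y].

Lemma perron_spectral_radius e rho x : symmetric e -> is_perron e rho x ->
  is_spectral_radius e rho.
Proof.
move=> sym [_ [i xi] hx ub]; split.
  by apply/eigenvalue_adj => //; exists x => //; exists i; rewrite gt_eqF.
move=> mu /(eigenvalue_adj _ sym)[y [j yj] hy].
have := ub y; have -> : qform e y = mu * sqnorm y.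
  by rewrite mulr_sumr; apply: eq_bigr => k _; rewrite hy; ring.
by rewrite ler_pM2r // (sqnorm_gt0 yj).
Qed.

Lemma qform_continuous e : continuous (fun v : 'rV[R]_n => qform e (v ord0)).
Proof.
have hc i : continuous (fun v : 'rV[R]_n => v ord0 i) by exact: coord_continuous.
have hs i : continuous (fun v : 'rV[R]_n => nbsum e (v ord0) i).
  by apply: (continuous_big add_continuous) => j _; exact: hc.
apply: (continuous_big add_continuous) => i _ v.
exact: (continuousM (hc i v) (hs i v)).
Qed.

Lemma sqnorm_continuous : continuous (fun v : 'rV[R]_n => sqnorm (v ord0)).
Proof.
have hc i : continuous (fun v : 'rV[R]_n => v ord0 i) by exact: coord_continuous.
apply: (continuous_big add_continuous) => i _ v.
exact: (continuousM (hc i v) (hc i v)).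
Qed.

Lemma sphere_compact : compact [set v : 'rV[R]_n | sqnorm (v ord0) = 1]%classic.
Proof.
have box := @rV_compact R n (fun=> `[-1, 1]%classic) (fun=> @segment_compact _ _ _).
apply: subclosed_compact box _.
  apply: (@preimage_closed _ _ (fun v : 'rV[R]_n => sqnorm (v ord0)) [set x | x = 1]%classic).
    by move=> v _; apply: sqnorm_continuous.
  exact: closed_eq.
move=> v /= hv i; rewrite /= in_itv /= -ler_norml -[`|_| <= _]ler_sqr ?nnegrE //.
rewrite expr1n -hv real_normK ?num_real // /sqnorm (bigD1 i) //= lerDl.
by apply: sumr_ge0 => j _; apply: sqr_ge0.
Qed.

(** The quadratic form attains a maximum on the compact unit sphere. Passing to absolute values
    keeps the norm and does not lower the form, so a nonnegative maximiser exists, and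
    [maximizer_eigen] makes it an eigenvector. *)
Lemma perron_exists e (i0 : 'I_n) : symmetric e ->
  exists rho x, is_perron e rho x.
Proof.
move=> sym.
have [] := @EVT_max_rV R n (fun v => qform e (v ord0)) _ _ sphere_compact.
  exists (\row_i (i == i0)%:R) => /=; rewrite /sqnorm (bigD1 i0) //= big1.
    by rewrite mxE eqxx expr1n addr0.
  by move=> i /negbTE ii0; rewrite mxE ii0 expr0n.
  apply: continuous_subspaceT; exact: qform_continuous.
move=> c; rewrite inE /= => c1 cmax; pose rho := qform e (c ord0).
(* Homogeneity carries the bound from the sphere to all vectors. *)
have ub y : qform e y <= rho * sqnorm y.
  have [y0|y0] := leP (sqnorm y) 0.
    have /sqnorm_eq0 z : sqnorm y = 0 by apply/eqP; rewrite eq_le y0 sqnorm_ge0.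
    have -> : sqnorm y = 0 by apply/eqP; rewrite eq_le y0 sqnorm_ge0.
    by rewrite mulr0 /qform big1 // => i _; rewrite z mul0r.
  pose s := (Num.sqrt (sqnorm y))^-1.
  have s2 : s ^+ 2 * sqnorm y = 1 by rewrite exprVn sqr_sqrtr ?ltW // mulVf ?gt_eqF.
  have := cmax (\row_i (s * y i)); rewrite inE /= => H.
  have qE : qform e ((\row_i (s * y i)) ord0) = s ^+ 2 * qform e y.
    rewrite /qform mulr_sumr; apply: eq_bigr => i _; rewrite mxE /nbsum.
    under eq_bigr do rewrite mxE.
    by rewrite -mulr_sumr; ring.
  have nE : sqnorm ((\row_i (s * y i)) ord0) = s ^+ 2 * sqnorm y.
    by rewrite /sqnorm mulr_sumr; apply: eq_bigr => i _; rewrite mxE exprMn.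
  have {}H := H (etrans nE s2); rewrite qE in H.
  have s0 : 0 < s ^+ 2 by rewrite exprn_gt0 // invr_gt0 sqrtr_gt0.
  by rewrite -(ler_pM2l s0) mulrCA s2 mulr1.
pose x i := `|c ord0 i|.
have nx : sqnorm x = 1.
  by rewrite -c1; apply: eq_bigr => i _; rewrite real_normK ?num_real.
have qx : rho * sqnorm x <= qform e x.
  rewrite nx mulr1; apply: ler_sum => i _; rewrite (le_trans (ler_norm _)) // normrM.
  by rewrite ler_wpM2l // ler_norm_sum.
exists rho, x; split=> //; first by move=> i; apply: normr_ge0.
  have [/existsP[i xi]|/existsPn h] := boolP [exists i, x i != 0].
    by exists i; rewrite lt0r xi normr_ge0.
  move: nx; rewrite /sqnorm big1 => [/eqP|i _]; first by rewrite eq_sym oner_eq0.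
  by have := h i; rewrite negbK => /eqP ->; rewrite expr0n.
exact: maximizer_eigen.
Qed.

End Spectrum.

(** * Graphs with a dominating vertex *)

Section Counting.
Variable n : nat.
Implicit Types (e f : rel 'I_n) (u v w : 'I_n) (P Q : pred 'I_n).

Definition degin e P u := #|[pred w | e u w && P w]|.

Lemma degreeE e u : degree e u = degin e xpredT u.
Proof. by apply: eq_card => w; rewrite !inE andbT. Qed.

Lemma degin_sum e P u : degin e P u = \sum_(w | e u w && P w) 1.
Proof. by rewrite sum1_card. Qed.

Lemma degin_split e P Q u :
  degin e P u = degin e (predI P Q) u + degin e (predD P Q) u.
Proof.
rewrite !degin_sum (bigID Q) /=; congr (_ + _); apply: eq_bigl => w /=.
  by rewrite andbA.
by case: (e u w); case: (P w); case: (Q w).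
Qed.

Lemma degin_exchange e P Q : symmetric e ->
  \sum_(u | P u) degin e Q u = \sum_(w | Q w) degin e P w.
Proof.
move=> sym; under eq_bigr do rewrite degin_sum.
under [RHS]eq_bigr do rewrite degin_sum.
rewrite (exchange_big_dep Q) => [|u w _ /andP[]] //=.
by apply: eq_bigr => w Qw; apply: eq_bigl => u; rewrite Qw andbT sym andbC.
Qed.

Lemma degin_le e P u : degin e P u <= #|P|.
Proof. by apply/subset_leq_card/subsetP=> w; rewrite !inE => /andP[]. Qed.

Lemma handshake e : simple_graph e -> \sum_v degree e v = (num_edges e).*2.
Proof.
move=> sg; rewrite -sum_deg; last by move=> A; apply: edge_set_card2.
by apply: eq_bigr => v _; rewrite deg_edge_set.
Qed.

Lemma admissible_packs k e : admissible k e <-> simple_graph e /\ ~ packs k (edge_set e).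
Proof. by split=> -[sg h]; split=> // /(packs_cycles k sg). Qed.

Lemma num_edges_lt k e : admissible k e -> num_edges e < n + (4 * k ^ 2 - 3).
Proof.
move/admissible_packs=> [sg h]; rewrite ltnNge; apply/negP=> le.
apply: h; apply: (@packs_excess _ k [set: 'I_n]); last by rewrite cardsT card_ord.
  by move=> A; apply: edge_set_card2.
by move=> A _; apply: subsetT.
Qed.

Lemma codegree_lt k e v u : admissible k e -> u != v -> degin e (e v) u < k.*2.
Proof.
move/admissible_packs=> [[irr sym] h] uv; rewrite ltnNge; apply/negP=> le; apply: h.
apply: (@packs_codeg _ k _ u v [set w | e u w && e v w]) => //.
- by rewrite inE irr.
- by rewrite inE irr andbF.
- by move=> w; rewrite inE => /andP[? ?]; rewrite !in_edge_set.
- by apply: leq_trans le _; apply/subset_leq_card/subsetP=> w; rewrite !inE.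
Qed.

(** The edges inside the neighbourhood of [v] form a graph [e'] with degrees at most [2 * k + 1] by
    [codegree_lt]; more than [2 * (2 * k + 1) * k] of them would yield [k.+1] edge-disjoint
    triangles. The sum counts each edge twice. *)
Lemma nbhd_edges_le k e v : admissible k.+1 e ->
  \sum_(u | e v u) degin e (e v) u <= 4 * (2 * k + 1) * k.
Proof.
move=> adm; have /admissible_packs[sg h] := adm; have [irr sym] := sg.
pose e' : rel 'I_n := fun u w => [&& e u w, e v u & e v w].
have sg' : simple_graph e'.
  by split=> [u|u w]; rewrite /e' ?irr // sym [e v u && _]andbC.
have dE u : degree e' u = if e v u then degin e (e v) u else 0.
  case vu: (e v u); first by apply: eq_card => w; rewrite !inE /e' vu.
  by apply: eq_card0 => w; rewrite !inE /e' vu andbF.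
have -> : \sum_(u | e v u) degin e (e v) u = (num_edges e').*2.
  by rewrite -handshake // big_mkcond; apply: eq_bigr => u _; rewrite dE.
have [le|lt] := leqP (num_edges e') (2 * (2 * k + 1) * k); first by lia.
case: h; apply: (@packs_triangles _ k (2 * k + 1) _ (edge_set e') v) => //.
- by apply/subsetP=> A /edge_setP[u [w [/and3P[euw _ _] ->]]]; rewrite in_edge_set.
- by move=> A; apply: edge_set_card2.
- move=> A u /edge_setP[a [b [/and3P[_ va vb] ->]]] uab.
  have vu : e v u by move: uab; rewrite !inE => /orP[]/eqP->.
  by rewrite in_edge_set //; split=> //; apply: contraTneq vu => ->; rewrite irr.
- move=> u; rewrite deg_edge_set // dE; case vu: (e v u) => //.
  have := @codegree_lt _ _ v u adm; rewrite doubleS -mul2n addn1 ltnS; apply.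
  by apply: contraTneq vu => ->; rewrite irr.
Qed.

Lemma degree_lt e u : irreflexive e -> degree e u <= n.-1.
Proof.
move=> irr; have := cardsC1 u; rewrite card_ord => <-.
apply/subset_leq_card/subsetP=> w; rewrite !inE; apply: contraTneq => ->.
by rewrite irr.
Qed.

Lemma degree_full e v : irreflexive e -> degree e v = n.-1 -> forall u, e v u = (u != v).
Proof.
move=> irr dv u; have sub : [set w | e v w] \subset [set~ v].
  by apply/subsetP=> w; rewrite !inE; apply: contraTneq => ->; rewrite irr.
have /eqP/setP/(_ u) : [set w | e v w] == [set~ v].
  by rewrite eqEcard sub cardsC1 card_ord -dv leqnn.
by rewrite !inE.
Qed.

Lemma max_degreeP e : irreflexive e -> 0 < n ->
  (exists v, degree e v = n.-1) <-> max_degree e = n.-1.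
Proof.
move=> irr n0; split=> [[v dv]|]; last first.
  rewrite /max_degree; have [|v ->] := @eq_bigmax _ (degree e); first by rewrite card_ord.
  by exists v.
apply/eqP; rewrite eqn_leq -{2}dv leq_bigmax andbT.
by apply/bigmax_leqP=> u _; apply: degree_lt.
Qed.

Definition star v : rel 'I_n := fun u w => (u == v) (+) (w == v).

(** Every edge of the star has an end of degree 1, which no even set can contain. *)
Lemma star_admissible k v : admissible k.+1 (star v).
Proof.
have sg : simple_graph (star v).
  by split=> [u|u w]; rewrite /star ?addbb // addbC.
apply/admissible_packs; split=> //= -[F [sF /set0Pn[A AF] evF _]].
have /edge_setP[a [b [eab eA]]] := subsetP sF _ AF.
have [u uv uA] : exists2 u, u != v & u \in A.
  move: eab; rewrite /star eA; have [->|av] := eqVneq a v => [/= bv|_].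
    by exists b; rewrite ?set22.
  by exists a; rewrite ?set21.
have : deg F u <= 1.
  apply: leq_trans (deg_sub _ sF) _; rewrite deg_edge_set //.
  rewrite -(cards1 v); apply/subset_leq_card/subsetP=> w.
  by rewrite !inE /star (negbTE uv).
have : 0 < deg F u by apply/deg_gt0P; exists A.
by have := evF u; case: (deg F u) => [|[|d]].
Qed.

Lemma degree_star v : degree (star v) v = n.-1.
Proof.
have := cardsC1 v; rewrite card_ord => <-.
by apply: eq_card => w; rewrite !inE /star eqxx.
Qed.

(* Detaching [u] and hanging it on [v] creates no cycle. *)
Definition rehang e u v : rel 'I_n :=
  fun a b => if a == u then b == v else if b == u then a == v else e a b.

Lemma rehang_sym e u v : symmetric e -> symmetric (rehang e u v).
Proof.
move=> sym a b; rewrite /rehang.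
by case: (a =P u) => [->|_]; case: (b =P u) => [bu|_] //; rewrite bu.
Qed.

Lemma rehang_admissible k e u v : u != v -> admissible k e -> admissible k (rehang e u v).
Proof.
move=> uv /admissible_packs[[irr sym] h].
have sg : simple_graph (rehang e u v).
  split=> [a|]; last exact: rehang_sym.
  by rewrite /rehang; case: eqP => [->|_]; [apply/negbTE | apply: irr].
apply/admissible_packs; split=> // p; apply: h; apply: packs_edges p.
  move=> A /edge_setP[a [b [+ ->]]]; rewrite /rehang.
  have [->|au] := eqVneq a u; first by move=> /eqP ->; right.
  have [->|bu] := eqVneq b u; first by move=> /eqP ->; right; rewrite setUC.
  by move=> eab; left; rewrite in_edge_set.
rewrite deg_edge_set // -(cards1 v); apply/subset_leq_card/subsetP=> w.
by rewrite !inE /rehang eqxx.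
Qed.

End Counting.

(** * Eigenvector estimates for a dominating vertex and for rehanging *)

Section Extremal.
Import Order.TTheory GRing.Theory Num.Theory.
Local Open Scope ring_scope.
Variables (R : realType) (n : nat).
Implicit Types (e f : rel 'I_n) (x y : 'I_n -> R) (u v w : 'I_n) (P Q : pred 'I_n).

Lemma perron_scale e (rho a : R) x : 0 < a -> is_perron e rho x ->
  is_perron e rho (fun i => a * x i).
Proof.
move=> a0 [x0 [i xi] hx ub]; split=> //.
- by move=> j; rewrite mulr_ge0 // ltW.
- by exists i; rewrite mulr_gt0.
- by move=> j; rewrite /nbsum -mulr_sumr -/(nbsum e x j) hx mulrCA.
Qed.

Lemma perron_normalized e (rho : R) x : is_perron e rho x ->
  exists v y, [/\ is_perron e rho y, y v = 1 & forall u, y u <= 1].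
Proof.
move=> px; have [x0 [i xi] _ _] := px.
have [v _ maxv] := @arg_maxP _ _ _ i xpredT x isT.
have xv : 0 < x v by apply: lt_le_trans xi (maxv i isT).
exists v, (fun j => (x v)^-1 * x j); split.
- by apply: perron_scale; rewrite ?invr_gt0.
- by rewrite mulVf // gt_eqF.
- by move=> u; rewrite ler_pdivrMl // mulr1; apply: maxv.
Qed.

Lemma degin_sum_le e P x u (M : R) : (forall w, e u w -> P w -> x w <= M) ->
  \sum_(w | e u w && P w) x w <= (degin e P u)%:R * M.
Proof.
move=> h; rewrite mulr_natl -sumr_const.
by apply: ler_sum => w /andP[]; apply: h.
Qed.

Lemma degin_sum_ge e P x u (M : R) : (forall w, e u w -> P w -> M <= x w) ->
  (degin e P u)%:R * M <= \sum_(w | e u w && P w) x w.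
Proof.
move=> h; rewrite mulr_natl -sumr_const.
by apply: ler_sum => w /andP[]; apply: h.
Qed.

Lemma degin_weighted e P Q x : symmetric e ->
  \sum_(u | P u) \sum_(w | e u w && Q w) x w = \sum_(w | Q w) (degin e P w)%:R * x w.
Proof.
move=> sym; rewrite (exchange_big_dep Q) => [|u w _ /andP[]] //=.
apply: eq_bigr => w Qw; rewrite mulr_natl -sumr_const.
by apply: eq_bigl => u; rewrite inE Qw andbT sym andbC.
Qed.

Lemma nbsum_split e x u v : symmetric e ->
  nbsum e x u = (e v u)%:R * x v + \sum_(w | e u w && (w != v)) x w.
Proof.
move=> sym; rewrite /nbsum; case euv: (e v u).
  by rewrite (bigD1 v) /= 1?sym // mul1r.
rewrite mul0r add0r; apply: eq_bigl => w; case: eqP => [->|_]; last by rewrite andbT.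
by rewrite sym euv.
Qed.

(** The sum is twice the number of edges that avoid [v]; the remaining [n.-1] edges are those at
    [v]. *)
Lemma full_degin_sum e v : simple_graph e -> degree e v = n.-1 ->
  (\sum_(u | u != v) degin e (predC1 v) u + n.-1.*2 = (num_edges e).*2)%N.
Proof.
move=> sg dv; have [irr sym] := sg; have full := degree_full irr dv.
rewrite -handshake // [RHS](bigD1 v) //= dv.
rewrite [in RHS](eq_bigr (fun u => degin e (predC1 v) u + 1)%N).
  rewrite big_split /= sum1_card cardC1 card_ord; lia.
move=> u uv; rewrite degreeE (degin_split _ _ (predC1 v)); congr (_ + _)%N.
rewrite -(card1 v); apply: eq_card => w; rewrite !inE andbT /=.
by have [->|_] := eqVneq w v; rewrite ?andbF // sym full uv.
Qed.

(** Every entry off [v] satisfies [sigma * y u >= y v]. Inserting this into the eigenvalue equation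
    at each [u], summing over [u != v] and using [sigma * y v = \sum_(u | u != v) y u] gives the
    bound multiplied by [y v]. *)
Lemma full_lower_bound f v (sigma : R) y : (1 < n)%N -> simple_graph f ->
  degree f v = n.-1 -> is_perron f sigma y ->
  0 < sigma /\
  (num_edges f).*2%:R - (n.-1).*2%:R <= (sigma ^+ 2 - n.-1%:R) * sigma.
Proof.
move=> n1 sg dv [y0 [i yi] hy _]; have [irr sym] := sg; have full := degree_full irr dv.
have sumv : sigma * y v = \sum_(u | u != v) y u.
  by rewrite -hy; apply: eq_bigl => u; rewrite full.
have hyu u : u != v -> sigma * y u = y v + \sum_(w | f u w && (w != v)) y w.
  by move=> uv; rewrite -hy (nbsum_split _ _ v) // full uv mul1r.
(* If [y v] vanished, the equation at [v] would make all other entries vanish too. *)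
have yv : 0 < y v.
  rewrite lt0r y0 andbT; apply: contraTneq yi => yv0.
  rewrite -leNgt; have [->|iv] := eqVneq i v; first by rewrite yv0.
  have := sumv; rewrite yv0 mulr0 (bigD1 i) //= => h.
  have : 0 <= \sum_(u | (u != v) && (u != i)) y u by apply: sumr_ge0 => *; apply: y0.
  by lra.
have yuv u : u != v -> y v <= sigma * y u.
  by move=> uv; rewrite hyu // lerDl; apply: sumr_ge0 => *; apply: y0.
have [u uv] : exists u, u != v.
  have /card_gt0P[u] : (0 < #|predC1 v|)%N by rewrite cardC1 card_ord; lia.
  by rewrite inE => uv; exists u.
have sigma0 : 0 < sigma.
  by rewrite ltNge; apply/negP=> s0; have := yuv u uv; have := y0 u; nra.
split=> //; set S := (\sum_(u | u != v) degin f (predC1 v) u)%N.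
have -> : (num_edges f).*2%:R - (n.-1).*2%:R = S%:R :> R.
  by rewrite -(full_degin_sum sg dv) natrD addrK.
have lb u' : u' != v -> sigma * y v + (degin f (predC1 v) u')%:R * y v <= sigma * (sigma * y u').
  move=> u'v; rewrite (hyu u') // mulrDr lerD2l mulr_sumr.
  by apply: degin_sum_ge => w _; apply: yuv.
have : \sum_(u' | u' != v) (sigma * y v + (degin f (predC1 v) u')%:R * y v)
       <= \sum_(u' | u' != v) sigma * (sigma * y u') by apply: ler_sum.
rewrite big_split /= sumr_const cardC1 card_ord -mulr_suml -natr_sum -/S -!mulr_sumr -sumv.
rewrite -mulr_natl => h; rewrite -(ler_pM2r yv); nra.
Qed.

(** Dropping the edges at [u] loses [2 * x u * (rho * x u)], and the new edge to [v] contributes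
    [2 * x u * x v]. *)
Lemma rehang_qform e x u v (rho : R) : simple_graph e -> u != v -> ~~ e v u ->
  (forall i, nbsum e x i = rho * x i) ->
  qform (rehang e u v) x = rho * sqnorm x + 2 * x u * (x v - rho * x u).
Proof.
move=> [irr sym] uv vu hx.
have nu : nbsum (rehang e u v) x u = x v.
  by rewrite /nbsum (eq_bigl (pred1 v)) ?big_pred1_eq // => w; rewrite /rehang eqxx.
have ni i : i != u -> nbsum (rehang e u v) x i = rho * x i - (e u i)%:R * x u + (i == v)%:R * x u.
  move=> iu; rewrite -hx (nbsum_split _ _ u sym) [_ * _ + _]addrC addrK.
  rewrite {1}/nbsum (bigID (pred1 u)) /= addrC; congr (_ + _).
    by apply: eq_bigl => w; rewrite /rehang (negbTE iu); case: eqP; rewrite ?andbF.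
  rewrite /rehang (negbTE iu); case iv: (i == v).
    by rewrite mul1r (eq_bigl (pred1 u)) ?big_pred1_eq // => w /=; case: eqP; rewrite ?andbF.
  by rewrite mul0r big_pred0 // => w; case: eqP; rewrite ?andbF.
have su : \sum_(i | i != u) x i * ((e u i)%:R * x u) = rho * x u * x u.
  rewrite -hx /nbsum mulr_suml [RHS]big_mkcond [LHS]big_mkcond; apply: eq_bigr => i _.
  have [->|_] /= := eqVneq i u; first by rewrite irr.
  by case: (e u i); rewrite ?mul1r // mul0r mulr0.
have sv : \sum_(i | i != u) x i * ((i == v)%:R * x u) = x v * x u.
  rewrite (bigD1 v) 1?eq_sym //= eqxx mul1r big1 ?addr0 // => i /andP[_ /negbTE ->].
  by rewrite mul0r mulr0.
rewrite /qform (bigD1 u) //= nu.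
rewrite (eq_bigr (fun i => x i * (rho * x i) - x i * ((e u i)%:R * x u) + x i * ((i == v)%:R * x u))).
  rewrite !big_split /= sumrN su sv /sqnorm [in RHS](bigD1 u) //= mulrDr mulr_sumr.
  rewrite (eq_bigr (fun i => rho * x i ^+ 2)); last by move=> i _; ring.
  by ring.
by move=> i iu; rewrite ni //; ring.
Qed.

(** If [rho * x u <= 1], rehanging [u] would not lower the form, so [x] would be an eigenvector for
    [rho] in the new graph as well. Comparing the two equations at [v] gives [x u = 0], and the new
    equation at [u] then gives [x v = 0]. *)
Lemma nonneighbour_weight e x u v (rho sigma : R) y : simple_graph e -> u != v -> ~~ e v u ->
  is_perron e rho x -> x v = 1 -> is_perron (rehang e u v) sigma y -> sigma <= rho ->
  1 < rho * x u.
Proof.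
move=> sg uv vu [x0 _ hx _] xv [_ _ _ ub] le; have [irr sym] := sg.
rewrite ltNge; apply/negP=> small.
have sym' := rehang_sym u v sym.
have eig := @maximizer_eigen R n (rehang e u v) x rho sym'.
have {}eig : forall i, nbsum (rehang e u v) x i = rho * x i.
  apply: eig => [z|].
    by apply: le_trans (ub z) _; apply: ler_wpM2r => //; apply: sqnorm_ge0.
  rewrite (rehang_qform sg uv vu hx) xv lerDl mulr_ge0 ?mulr_ge0 ?x0 //.
  by rewrite subr_ge0.
have : x u = 0.
  have := eig v; rewrite -(hx v) [nbsum (rehang e u v) x v](nbsum_split _ _ u) //.
  rewrite [nbsum e x v](nbsum_split _ _ u) // sym (negbTE vu) mul0r add0r.
  rewrite /rehang eqxx eqxx mul1r => /eqP.
  rewrite (eq_bigl (fun w => e v w && (w != u))).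
    by rewrite -[X in _ == X]add0r (inj_eq (addIr _)) => /eqP.
  by move=> w; rewrite [v == u]eq_sym (negbTE uv); case: (w == u); rewrite ?andbF.
move=> xu; have := eig u.
rewrite /nbsum (eq_bigl (pred1 v)) ?big_pred1_eq; last by move=> w; rewrite /rehang eqxx.
by rewrite xv xu mulr0 => /eqP; rewrite oner_eq0.
Qed.

End Extremal.

Lemma gain_arith k a : a <= 4 * (2 * k + 1) * k ->
  (2 * k + 1) * a + 2 <= 2 * ((2 * k + 1) * (2 * (2 * k + 1) * k) + 1).
Proof. by move=> h; have := leq_mul (leqnn (2 * k + 1)) h; lia. Qed.

(** * The extremal graph: a dominating vertex and the number of edges *)

Section Dominating.
Import Order.TTheory GRing.Theory Num.Theory.
Local Open Scope ring_scope.
Variables (R : realType) (n : nat).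
Implicit Types (e f : rel 'I_n) (x y : 'I_n -> R) (u v w : 'I_n) (P Q : pred 'I_n).

(** [M] is the largest entry off [v]; the eigenvalue equation where it is attained gives
    [rho * M <= 1 + d%:R * M]. *)
Lemma off_max e v (rho : R) x (d : nat) : (1 < n)%N -> simple_graph e ->
  is_perron e rho x -> x v = 1 ->
  (forall u, u != v -> (degin e (predC1 v) u <= d)%N) ->
  exists M, [/\ forall u, u != v -> x u <= M, (rho - d%:R) * M <= 1 &
                forall u, u != v -> rho * x u <= (e v u)%:R + d%:R * M].
Proof.
move=> n1 [irr sym] [x0 _ hx _] xv dd.
have [u0 u0v] : exists u, u != v.
  have /card_gt0P[u] : (0 < #|predC1 v|)%N by rewrite cardC1 card_ord; lia.
  by rewrite inE => uv; exists u.
have [w wv maxw] := @arg_maxP _ _ _ u0 (fun u => u != v) x u0v.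
have key u : u != v -> rho * x u <= (e v u)%:R + d%:R * x w.
  move=> uv; rewrite -hx (nbsum_split _ _ v sym) xv mulr1 lerD2l.
  apply: le_trans (degin_sum_le (P := predC1 v) (M := x w) _) _.
    by move=> z _; apply: maxw.
  by apply: ler_wpM2r => //; rewrite ler_nat dd.
exists (x w); split=> //; have := key w wv; rewrite mulrBl.
have : (e v w)%:R <= 1 :> R by case: (e v w); rewrite ?ler01.
by lra.
Qed.

(** Two steps from [v] give [rho ^+ 2] as [n.-1] plus the entries off [v] weighted by their degrees
    outside [v]; multiplying by [rho] allows each entry to be bounded by [ub]. *)
Lemma full_upper_bound e v (rho M : R) x (d : nat) : simple_graph e ->
  degree e v = n.-1 -> is_perron e rho x -> x v = 1 ->
  (forall u, u != v -> rho * x u <= (e v u)%:R + d%:R * M) ->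
  (rho ^+ 2 - n.-1%:R) * rho <=
  ((num_edges e).*2%:R - (n.-1).*2%:R) * (1 + d%:R * M).
Proof.
move=> sg dv [x0 _ hx _] xv ub; have [irr sym] := sg; have full := degree_full irr dv.
set S := (\sum_(u | u != v) degin e (predC1 v) u)%N.
have -> : (num_edges e).*2%:R - (n.-1).*2%:R = S%:R :> R.
  by rewrite -(full_degin_sum sg dv) natrD addrK.
have sumv : rho = \sum_(u | u != v) x u.
  by rewrite -[rho]mulr1 -xv -hx; apply: eq_bigl => u; rewrite full.
have rho2 : rho ^+ 2 = n.-1%:R + \sum_(w | w != v) (degin e (predC1 v) w)%:R * x w.
  rewrite -(degin_weighted _ _ _ sym) expr2 {2}sumv mulr_sumr.
  rewrite (eq_bigr (fun u => 1 + \sum_(w | e u w && predC1 v w) x w)).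
    by rewrite big_split /= sumr_const cardC1 card_ord.
  by move=> u uv; rewrite -hx (nbsum_split _ _ v sym) full uv mul1r xv.
rewrite rho2 addrAC subrr add0r mulr_suml natr_sum mulr_suml.
apply: ler_sum => w wv; rewrite -mulrA ler_wpM2l // mulrC.
by have := ub w wv; rewrite full wv.
Qed.

(** [64 * k ^ 6] is the square of [8 * k ^ 3]; the strict inequality on [a] absorbs the loss from
    [n] to [n.-1]. *)
Lemma natr_le_rho (rho : R) (k a : nat) : (64 * k ^ 6 <= n)%N -> (a < 8 * k ^ 3)%N ->
  0 <= rho -> n.-1%:R <= rho ^+ 2 -> a%:R <= rho.
Proof.
move=> hn ha rho0 hrho; rewrite -ler_sqr ?nnegrE ?ler0n //; apply: le_trans hrho.
rewrite -natrX ler_nat.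
have : ((a + 1) ^ 2 <= 64 * k ^ 6)%N.
  have -> : (64 * k ^ 6 = (8 * k ^ 3) ^ 2)%N by rewrite expnMn -expnM.
  by rewrite leq_exp2r // addn1.
by rewrite -!mulnn; nia.
Qed.

Lemma extremal_dominating k e v (rho : R) x : (64 * k.+1 ^ 6 <= n)%N ->
  admissible k.+1 e -> is_perron e rho x -> x v = 1 -> (forall u, x u <= 1) ->
  0 < rho -> n.-1%:R <= rho ^+ 2 ->
  (forall u, u != v -> ~~ e v u -> 1 < rho * x u) -> degree e v = n.-1.
Proof.
move=> hn adm px xv x1 rho0 hrho far; have [x0 _ hx _] := px.
have /admissible_packs[sg _] := adm; have [irr sym] := sg.
(* [Q] is the set of non-neighbours of [v], to be shown empty; [gN] and [gQ] count neighbours inside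
   the neighbourhood of [v] and inside [Q]. *)
pose Q : pred 'I_n := fun u => (u != v) && ~~ e v u.
pose gN u := degin e (e v) u; pose gQ u := degin e Q u.
pose c := (4 * k.+1 ^ 2 - 3)%N; pose c' := (c + 2 * (2 * k + 1) * k)%N.
pose D := (2 * k + 1 + c')%N.
have vQ u : e v u -> u != v by apply: contraTneq => ->; rewrite irr.
have dgE u : degin e (predC1 v) u = (gN u + gQ u)%N.
  rewrite (degin_split _ _ (e v)); congr (_ + _)%N; apply: eq_card => w; rewrite !inE.
    by case evw: (e v w); rewrite ?andbF // (vQ w evw) ?andbT.
  by rewrite /Q [(w != v) && _]andbC.
have dE u : degree e u = (e v u + (gN u + gQ u))%N.
  rewrite -dgE degreeE (degin_split _ _ (pred1 v)); congr (_ + _)%N.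
    case evu: (e v u).
      have -> : true = #|pred1 v| :> nat by rewrite card1.
      apply: eq_card => w; rewrite !inE /=.
      by have [->|] := eqVneq w v; rewrite ?andbF // sym evu.
    apply: eq_card0 => w; rewrite !inE /=.
    by have [->|] := eqVneq w v; rewrite ?andbF // sym evu.
  by apply: eq_card => w; rewrite !inE /= andbT.
have nE : n.-1 = (degree e v + #|Q|)%N.
  have := cardC1 v; rewrite card_ord => <-.
  rewrite -(cardID (e v) (predC1 v)); congr (_ + _)%N; apply: eq_card => w; rewrite !inE.
    by rewrite /in_mem /= andbC; case evw: (e v w); rewrite ?andbF // (vQ w evw).
  by rewrite /Q /in_mem /= andbC.
pose SNN := (\sum_(u | e v u) gN u)%N; pose SQN := (\sum_(u | Q u) gN u)%N.
pose SQQ := (\sum_(u | Q u) gQ u)%N.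
have SNNle : (SNN <= 4 * (2 * k + 1) * k)%N by apply: nbhd_edges_le.
have gN_le u : u != v -> (gN u <= 2 * k + 1)%N.
  by move=> uv; have := codegree_lt adm uv; rewrite -/(gN u); lia.
have total : ((num_edges e).*2 = (degree e v).*2 + SNN + SQN.*2 + SQQ)%N.
  rewrite -handshake // (bigD1 v) //= (bigID (e v)) /=.
  rewrite (eq_bigl (e v)); last by move=> u; case evu: (e v u); rewrite ?andbF // (vQ u evu).
  rewrite (eq_bigr (fun u => 1 + (gN u + gQ u))%N); last by move=> u evu; rewrite dE evu.
  rewrite [X in (_ + (_ + X))%N](eq_bigr (fun u => gN u + gQ u)%N); last first.
    by move=> u /andP[_ /negbTE evu]; rewrite dE evu.
  rewrite !big_split /= sum1_card.
  have -> : (\sum_(u | e v u) gQ u = SQN)%N by apply: degin_exchange.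
  have -> : #|[pred u | e v u]| = degree e v by apply: eq_card => w; rewrite !inE.
  by rewrite -/SNN -/SQN -/SQQ; lia.
have mlt : (num_edges e <= n.-1 + c)%N.
  have := num_edges_lt adm; rewrite -/c; have := ltn_ord v; lia.
(* The eigenvalue equation is applied twice from [v]; entries inside the neighbourhood of [v] are
   bounded by 1, those on [Q] are kept. *)
have walks : rho ^+ 2 <= (degree e v)%:R + SNN%:R + \sum_(w | Q w) (gN w)%:R * x w.
  have sumv : rho = \sum_(u | e v u) x u by rewrite -[rho]mulr1 -xv -hx.
  rewrite -(degin_weighted _ _ _ sym) expr2 {2}sumv mulr_sumr.
  have -> : (degree e v)%:R = \sum_(u | e v u) 1 :> R.
    by rewrite sumr_const; congr (_%:R); apply: eq_card => w; rewrite !inE.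
  rewrite natr_sum -!big_split /=; apply: ler_sum => u evu.
  rewrite -hx (nbsum_split _ _ v sym) evu mul1r xv -addrA lerD2l (bigID (e v)) /=.
  apply: lerD.
    rewrite (eq_bigl (fun w => e u w && e v w)).
      by rewrite -[leRHS]mulr1; apply: degin_sum_le => w _ _.
    by move=> w; rewrite -andbA; case evw: (e v w); rewrite ?andbF // (vQ w evw).
  by rewrite le_eqVlt; apply/orP; left; apply/eqP; apply: eq_bigl => w; rewrite /Q -andbA.
have wQ u : Q u -> u != v by case/andP.
have rhoxQ u : Q u -> rho * x u <= (gN u + gQ u)%:R.
  move=> Qu; have /andP[_ /negbTE evu] := Qu.
  rewrite -hx (nbsum_split _ _ v sym) evu mul0r add0r -dgE -[leRHS]mulr1.
  exact: degin_sum_le.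
have P_le (a : R) : (forall u, Q u -> x u <= a) -> \sum_(w | Q w) (gN w)%:R * x w <= a * SQN%:R.
  move=> h; rewrite natr_sum mulr_sumr; apply: ler_sum => w Qw.
  by rewrite mulrC ler_wpM2r // h.
have tle : (#|Q| <= SNN + SQN)%N.
  rewrite -(ler_nat R) natrD; have := P_le 1 (fun u _ => x1 u); rewrite mul1r => h.
  by move: hrho walks; rewrite nE natrD; lra.
have gQ_half w : Q w -> ((gQ w).*2 <= SQQ)%N.
  move=> Qw; rewrite /SQQ (bigD1 w) //= -addnn leq_add2l {1}/gQ degin_sum.
  rewrite big_mkcond [X in (_ <= X)%N]big_mkcond; apply: leq_sum => u _.
  case wu: (e w u); case Qu: (Q u) => //=.
  have -> /= : u != w by apply: contraTneq wu => ->; rewrite irr.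
  by apply/card_gt0P; exists w; rewrite inE sym wu.
(* Together [total], [mlt] and [tle] give [SQQ <= 2 * c + SNN]. *)
have gQ_le w : Q w -> (gQ w <= c')%N.
  by move=> Qw; have := gQ_half w Qw; rewrite /c'; lia.
have D_le w : Q w -> (gN w + gQ w <= D)%N.
  by move=> Qw; apply: leq_add; [apply: gN_le; apply: wQ | apply: gQ_le].
have D2 : (D.*2)%:R <= rho.
  apply: (natr_le_rho hn _ (ltW rho0) hrho).
  by rewrite /D /c' /c; nia.
have xhalf w : Q w -> x w <= 2^-1.
  move=> Qw; have h : rho * x w <= D%:R.
    by apply: le_trans (rhoxQ w Qw) _; rewrite ler_nat D_le.
  have : (D.*2)%:R = 2 * D%:R :> R by rewrite -mul2n natrM.
  by have := x0 w; nra.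
(* The argument for [tle] is repeated with the improved bound [1 / 2] on the entries over [Q]. *)
have t2 : (#|Q|.*2 <= SNN.*2 + SQN)%N.
  have := P_le _ xhalf => h; rewrite -(ler_nat R) natrD -!mul2n !natrM.
  by move: hrho walks; rewrite nE natrD; lra.
(* By [far] the integer [gN u + gQ u] exceeds 1, hence is at least 2. *)
have t3 : (#|Q|.*2 <= SQN + SQQ)%N.
  rewrite /SQN /SQQ -big_split /= -muln2 -sum_nat_const.
  apply: leq_sum => u Qu; have /andP[uv evu] := Qu.
  by rewrite -(ltr_nat R); apply: lt_le_trans (far u uv evu) (rhoxQ u Qu).
(* Adding [t2] and [t3] and comparing with [total] and [mlt] gives [2 * #|Q| <= SNN + 2 * c]. *)
have tc : (#|Q| <= c')%N by rewrite /c'; lia.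
apply/eqP; rewrite nE -[X in X == _]addn0 eqn_add2l eq_sym; apply/negPn/negP => Q0.
have /card_gt0P[u0] : (0 < #|Q|)%N by rewrite lt0n.
rewrite /in_mem /= => Qu0; have /andP[u0v evu0] := Qu0.
have n1 : (1 < n)%N.
  by have := expn_gt0 k.+1 6; lia.
(* Now every vertex other than [v] has at most [D] neighbours besides [v], so a vertex of [Q] would
   give [1 < D * M <= (rho - D) * M <= 1]. *)
have [|M [xM Mle xle]] := off_max (d := D) n1 sg px xv.
  move=> u uv; rewrite dgE; case evu: (e v u); last by apply: D_le; rewrite /Q uv evu.
  by apply: leq_add; [apply: gN_le | apply: leq_trans tc; apply: degin_le].
have := xle u0 u0v; rewrite (negbTE evu0) mulr0n add0r; have := far u0 u0v evu0.
have : 0 <= M by apply: le_trans (xM u0 u0v).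
move: Mle D2; rewrite -mul2n natrM.
by move: (D%:R : R) => DR; nra.
Qed.

Lemma full_radius e v (rho : R) x : (1 < n)%N -> simple_graph e ->
  degree e v = n.-1 -> is_perron e rho x -> 0 < rho /\ n.-1%:R <= rho ^+ 2.
Proof.
move=> n1 sg dv px; have [rho0 h] := full_lower_bound n1 sg dv px; split=> //.
rewrite -subr_ge0 -(pmulr_lge0 _ rho0); apply: le_trans h.
by rewrite -(full_degin_sum sg dv) natrD addrK.
Qed.

Lemma extremal_in_G1 k e (rho : R) x : (64 * k.+1 ^ 6 <= n)%N ->
  admissible k.+1 e -> is_perron e rho x ->
  (forall f (sigma : R) y, admissible k.+1 f -> is_perron f sigma y -> sigma <= rho) ->
  in_G1 k.+1 e.
Proof.
move=> hn adm /perron_normalized[v [{}x [px xv x1]]] best.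
have n1 : (1 < n)%N by have := expn_gt0 k.+1 6; lia.
have [sg _] := adm; have [irr sym] := sg.
have [rho0 hrho] : 0 < rho /\ n.-1%:R <= rho ^+ 2.
  have adms := star_admissible k v; have [sgs _] := adms.
  have [s [y py]] := @perron_exists R n (star v) v sgs.2.
  have [s0 hs] := full_radius n1 sgs (degree_star v) py.
  have le := best _ _ _ adms py; split; first exact: lt_le_trans le.
  by apply: le_trans hs _; rewrite ler_sqr ?nnegrE ?(ltW s0) // (le_trans (ltW s0)).
have dv : degree e v = n.-1.
  apply: (extremal_dominating hn adm px xv x1 rho0 hrho) => u uv vu.
  have [s [y py]] := @perron_exists R n (rehang e u v) v (rehang_sym u v sym).
  apply: (nonneighbour_weight sg uv vu px xv py).
  exact: (best _ _ _ (rehang_admissible uv adm) py).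
split=> //; first by apply/max_degreeP; [| lia | exists v].
move=> f admf /max_degreeP[//||v' dv']; [by case: admf => -[] | lia |].
have [sgf _] := admf; have [s [y py]] := @perron_exists R n f v' sgf.2.
have [s0 lb] := full_lower_bound n1 sgf dv' py; have [_ hs] := full_radius n1 sgf dv' py.
have sle := best _ _ _ admf py.
rewrite leqNgt; apply/negP=> lt.
have full := degree_full irr dv.
have dgE u : degin e (predC1 v) u = degin e (e v) u.
  by apply: eq_card => w; rewrite !inE full.
have dle u : u != v -> (degin e (predC1 v) u <= 2 * k + 1)%N.
  by move=> uv; rewrite dgE; have := codegree_lt adm uv; lia.
have [M [xM Mle xle]] := off_max n1 sg px xv dle.
have ub := full_upper_bound sg dv px xv xle.
have hS := full_degin_sum sg dv.
set S := (\sum_(u | u != v) degin e (predC1 v) u)%N in hS.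
have Sle : (S <= 4 * (2 * k + 1) * k)%N.
  apply: leq_trans (nbhd_edges_le v adm); rewrite /S (eq_bigl (e v)) => [|u]; last by rewrite full.
  by apply: leq_sum => u _; rewrite dgE.
have M0 : 0 <= M.
  have /card_gt0P[u] : (0 < #|predC1 v|)%N by rewrite cardC1 card_ord; lia.
  by rewrite inE => uv; apply: le_trans (xM u uv); have [] := px.
have big : (2 * k + 1 + ((2 * k + 1) * (2 * (2 * k + 1) * k) + 1))%:R <= rho.
  apply: (natr_le_rho hn _ (ltW rho0) hrho).
  by rewrite expnS -mulnn; nia.
have SE : (num_edges e).*2%:R - (n.-1).*2%:R = S%:R :> R by rewrite -hS natrD addrK.
(* One extra edge in [f] raises the doubled count by 2. *)
have SF : S%:R + 2 <= (num_edges f).*2%:R - (n.-1).*2%:R :> R.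
  by rewrite -SE addrAC lerD2r -natrD ler_nat; lia.
(* Both factors are nonnegative and grow with the radius. *)
have mono : (s ^+ 2 - n.-1%:R) * s <= (rho ^+ 2 - n.-1%:R) * rho.
  apply: ler_pM => //; rewrite ?subr_ge0 // ?(ltW s0) // lerD2r.
  by rewrite ler_sqr ?nnegrE ?(ltW s0) ?(ltW rho0).
have gain : 2 <= S%:R * ((2 * k + 1)%:R * M).
  have := le_trans SF (le_trans lb (le_trans mono ub)).
  by rewrite SE mulrDr mulr1 lerD2l.
have rhoS : ((2 * k + 1) * S + 2)%:R <= 2 * (rho - (2 * k + 1)%:R).
  apply: le_trans (_ : (2 * ((2 * k + 1) * (2 * (2 * k + 1) * k) + 1))%:R <= _).
    by rewrite ler_nat gain_arith.
  by rewrite natrM ler_pM2l ?ltr0n // lerBrDl -natrD.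
move: gain rhoS Mle; rewrite [((2 * k + 1) * S + 2)%:R]natrD natrM.
move: (S%:R : R) ((2 * k + 1)%:R : R) => a d gain rhoS Mle.
(* Multiplying [rhoS] by [M] and using [Mle] gives [a * d * M + 2 * M <= 2], while [gain] says
   [2 <= a * d * M]. *)
have M_le0 : M <= 0 by have := ler_wpM2r M0 rhoS; nra.
have M_eq0 : M = 0 by apply: le_anti; rewrite M_le0 M0.
by move: gain; rewrite M_eq0 !mulr0 lern0.
Qed.

End Dominating.

Theorem theorem5p1 (R : realType) (k n : nat) :
  1 <= k -> 64 * k ^ 6 <= n ->
  forall e : rel 'I_n, in_G2 R k e -> in_G1 k e.
Proof.
case: k => // k _ hn e [adm [r [[eigr _] ext]]].
have [sg _] := adm.
have n0 : 0 < n by have := expn_gt0 k.+1 6; lia.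
have [rho [x px]] := @perron_exists R n e (Ordinal n0) sg.2.
apply: (extremal_in_G1 hn adm px) => f sigma y admf pf.
(* The given radius [r] is an eigenvalue of [e], hence at most [rho], so extremality of [r] passes
   to [rho]. *)
have [_ rho_max] := perron_spectral_radius sg.2 px.
apply: Order.POrderTheory.le_trans (rho_max r eigr).
by apply: (ext f) => //; apply: perron_spectral_radius pf; case: (admf) => -[].
Qed.
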